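(* Let $m:\mathbb R\to\mathbb R$ be a domain wall profile, let $\chi(u)=C_0e^{-\int_0^u m(s)\,ds}$ with $C_0>0$ the normalization constant, and let $g\in\mathcal S(\mathbb R)$ (Schwartz space). Let $h\in C^2(\mathbb R)$ be real valued with $h'$ and $h''$ bounded on $\mathbb R$. For $0<\varepsilon\ll1$ consider the Dirac equation $$\mathrm i\partial_t\begin{pmatrix}\alpha_1\\ \alpha_2\end{pmatrix}+\begin{pmatrix}\mathrm i\partial_{x_2} & m\big(x_1+h(\varepsilon x_2)\big)-\partial_{x_1}\\ m\big(x_1+h(\varepsilon x_2)\big)+\partial_{x_1} & -\mathrm i\partial_{x_2}\end{pmatrix}\begin{pmatrix}\alpha_1\\ \alpha_2\end{pmatrix}=0,\qquad \mathbf x=(x_1,x_2)\in\mathbb R^2,$$ whose edge curve is $\Gamma=\{\mathbf x\in\mathbb R^2:x_1+h(\varepsilon x_2)=0\}$, and set $$\begin{pmatrix}\alpha_1\\ \alpha_2\end{pmatrix}_{\varepsilon}(t,\mathbf x)=\chi\big(x_1+h(\varepsilon x_2)\big)\,g\Big(-\varepsilon h'(\varepsilon x_2)\big(x_1+h(\varepsilon x_2)\big)+x_2-t\Big)\begin{pmatrix}1\\ \frac{\mathrm i}{2}\varepsilon h'(\varepsilon x_2)\end{pmatrix}.$$ Suppose that the initial condition is perfectly matched, i.e. $\binom{\alpha_1}{\alpha_2}(0,\mathbf x)=\binom{\alpha_1}{\alpha_2}_\varepsilon(0,\mathbf x)$. Then for any $t>0$, $$\Bigg\|\begin{pmatrix}\alpha_1\\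 \alpha_2\end{pmatrix}(t,\mathbf x)-\begin{pmatrix}\alpha_1\\ \alpha_2\end{pmatrix}_{\varepsilon}(t,\mathbf x)\Bigg\|_{L^2(\mathbb R^2)}<C\,t\,\varepsilon^2,$$ where $C$ is a constant independent of $t$ and $\varepsilon$.
   Context: Domain wall profile: a piecewise continuous monotonic transition function $m\in L^\infty(\mathbb R)$, real valued, vanishing exactly at $0$, with $\lim_{u\to\pm\infty}m(u)=\pm m_\infty$ for some $m_\infty>0$, the limits being approached rapidly. The normalization of $\chi$ is $\|\chi\|_{L^2(\mathbb R)}=1$. Writing the equation as $\mathrm i\partial_t\boldsymbol\alpha+\mathcal D^\varepsilon\boldsymbol\alpha=0$ with $\mathcal D^\varepsilon$ self-adjoint in $L^2(\mathbb R^2;\mathbb C^2)$ (domain $H^1(\mathbb R^2;\mathbb C^2)$), the solution with initial datum $\boldsymbol\alpha_0$ is $\boldsymbol\alpha(t)=e^{\mathrm i\mathcal D^\varepsilon t}\boldsymbol\alpha_0$, where $e^{\mathrm i\mathcal D^\varepsilon t}$ is unitary in $L^2$. The functions $m,g,h$ are fixed independently of $\varepsilon$ and $t$; ''$0<\varepsilon\ll1$'' means for all sufficiently small $\varepsilon>0$. *)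

(* Defs.v *)
From HB Require Import structures.
From mathcomp Require Import all_boot all_order all_algebra.
From mathcomp Require Import all_classical all_reals all_analysis.
From mathcomp Require Export complex.
Import Order.TTheory GRing.Theory Num.Theory.
Import numFieldNormedType.Exports.

Set Implicit Arguments.
Unset Strict Implicit.
Unset Printing Implicit Defensive.

Local Open Scope classical_set_scope.
Local Open Scope complex_scope.
Local Open Scope ring_scope.

(* Functions on the plane: x = (x.1, x.2) stands for (x_1, x_2). *)

Definition leb2 (R : realType) :
    {measure set (measurableTypeR R * measurableTypeR R)%type -> \bar R} :=
  (@lebesgue_measure R \x @lebesgue_measure R)%E.

Definition partial1 (R : realType) (f : R * R -> R) : R * R -> R :=
  fun x => derive1 (fun s => f (s, x.2)) x.1.

Definition partial2 (R : realType) (f : R * R -> R) : R * R -> R :=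
  fun x => derive1 (fun s => f (x.1, s)) x.2.

Fixpoint class_C (R : realType) (n : nat) (f : R * R -> R) : Prop :=
  continuous f /\
  if n is k.+1 then
    [/\ forall x : R * R, derivable (fun s => f (s, x.2)) x.1 1,
        forall x : R * R, derivable (fun s => f (x.1, s)) x.2 1,
        class_C k (partial1 f) & class_C k (partial2 f)]
  else True.

(* C_c^oo(R^2), real valued *)
Definition test_function (R : realType) (phi : R * R -> R) : Prop :=
  (forall n, class_C n phi) /\ compact (closure [set x | phi x != 0]).

Notation spinor R := ('cV[R[i]]_2).
Notation field2 R := (R * R -> spinor R).

Definition mk_spinor (R : realType) (a b : R[i]) : spinor R :=
  \col_(j < 2) (if j == 0 then a else b).

Definition spinor_norm (R : realType) (v : spinor R) : R :=
  Num.sqrt (\sum_(j < 2) (complex.Re (v j 0) ^+ 2 + complex.Im (v j 0) ^+ 2)).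

Definition L2norm (R : realType) (f : field2 R) : \bar R :=
  'N[leb2 R]_2%:E [EFin \o (@spinor_norm R \o f)]%E.

Definition in_L2 (R : realType) (f : field2 R) : Prop :=
  [/\ forall j, measurable_fun setT (fun x => complex.Re (f x j 0)),
      forall j, measurable_fun setT (fun x => complex.Im (f x j 0))
    & (L2norm f < +oo)%E].

(* int f d_k phi = - int g phi for all test functions; testing against real
   phi is enough, so the real and imaginary parts decouple. *)
Definition weak_derivative (R : realType)
    (partial : (R * R -> R) -> R * R -> R) (f g : R * R -> R) : Prop :=
  forall phi, test_function phi ->
    \int[leb2 R]_x (f x * partial phi x) = - \int[leb2 R]_x (g x * phi x).

Definition spinor_weak_derivative (R : realType)
    (partial : (R * R -> R) -> R * R -> R) (f g : field2 R) : Prop :=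
  forall j,
    weak_derivative partial (fun x => complex.Re (f x j 0))
                            (fun x => complex.Re (g x j 0)) /\
    weak_derivative partial (fun x => complex.Im (f x j 0))
                            (fun x => complex.Im (g x j 0)).

(* f is in H^1(R^2; C^2), with weak partial derivatives d1 and d2 *)
Definition H1_gradient (R : realType) (f d1 d2 : field2 R) : Prop :=
  [/\ in_L2 f, in_L2 d1, in_L2 d2,
      spinor_weak_derivative (@partial1 R) f d1
    & spinor_weak_derivative (@partial2 R) f d2].

(* Graph of the operator D^eps with domain H^1(R^2; C^2): w = D^eps f. *)
Definition dirac_op (R : realType) (m h : R -> R) (eps : R)
    (f w : field2 R) : Prop :=
  exists d1 d2 : field2 R, H1_gradient f d1 d2 /\
    w = (fun x =>
      let V := (m (x.1 + h (eps * x.2)))%:C in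
      mk_spinor ('i * d2 x 0 0 + (V * f x 1 0 - d1 x 1 0))
                ((V * f x 0 0 + d1 x 0 0) - 'i * d2 x 1 0)) %[ae leb2 R].

(* U t is e^{itA}: a strongly continuous one-parameter unitary group on L^2
   whose infinitesimal generator is exactly iA, domain included (Stone).
   Elements of L^2 are represented by functions, so identities hold a.e.;
   surjectivity of U t follows from the group law. *)
Record exp_group (R : realType) (A : field2 R -> field2 R -> Prop)
    (U : R -> field2 R -> field2 R) : Prop := {
  exp_L2 : forall t f, in_L2 f -> in_L2 (U t f);
  exp_linear : forall t (a : R[i]) f g, in_L2 f -> in_L2 g ->
    U t (fun x => a *: f x + g x) = (fun x => a *: U t f x + U t g x)
      %[ae leb2 R];
  exp_isometry : forall t f, in_L2 f -> L2norm (U t f) = L2norm f;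
  exp_0 : forall f, in_L2 f -> U 0 f = f %[ae leb2 R];
  exp_D : forall s t f, in_L2 f -> U (s + t) f = U s (U t f) %[ae leb2 R];
  exp_continuous : forall f, in_L2 f ->
    L2norm (fun x => U t f x - f x) @[t --> (0 : R)] --> 0%E;
  exp_generator : forall f w, in_L2 f -> in_L2 w ->
    A f w <->
    L2norm (fun x => (t^-1)%:C *: (U t f x - f x) - 'i *: w x)
      @[t --> (0 : R)^'] --> 0%E
}.

(* alpha(t) = e^{i D^eps t} alpha(0) *)
Definition dirac_solution (R : realType) (m h : R -> R) (eps : R)
    (alpha : R -> field2 R) : Prop :=
  (forall t, in_L2 (alpha t)) /\
  exists2 U, exp_group (dirac_op m h eps) U &
    forall t, alpha t = U t (alpha 0) %[ae leb2 R].

(* continuous except at finitely many points of each bounded interval, at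
   which both one-sided limits exist *)
Definition piecewise_continuous (R : realType) (f : R -> R) : Prop :=
  (forall a b : R,
     finite_set [set x | a <= x <= b /\ ~ {for x, continuous f}]) /\
  (forall x : R, cvg (f y @[y --> x^'-]) /\ cvg (f y @[y --> x^'+])).

Record domain_wall (R : realType) (m : R -> R) : Prop := {
  wall_piecewise : piecewise_continuous m;
  wall_monotone : {homo m : x y / x <= y};
  wall_measurable : measurable_fun setT m;
  wall_bounded : finite_norm (@lebesgue_measure R) +oo%E m;
  wall_zero : forall u, m u = 0 <-> u = 0;
  (* the limits are approached faster than any power of 1/|u| *)
  wall_limits : exists minf : R,
    [/\ 0 < minf,
        m u @[u --> +oo] --> minf,
        m u @[u --> -oo] --> - minf,
        forall k : nat, u ^+ k * (m u - minf) @[u --> +oo] --> (0 : R)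
      & forall k : nat, u ^+ k * (m u + minf) @[u --> -oo] --> (0 : R)]
}.

(* int_0^u m(s) ds, oriented *)
Definition primitive0 (R : realType) (m : R -> R) (u : R) : R :=
  if 0 <= u then \int[@lebesgue_measure R]_(s in `[0, u]) m s
  else - \int[@lebesgue_measure R]_(s in `[u, 0]) m s.

Definition chi (R : realType) (m : R -> R) (C0 : R) (u : R) : R :=
  C0 * expR (- primitive0 m u).

Definition schwartz_real (R : realType) (f : R -> R) : Prop :=
  (forall n x, derivable (derive1n n f) x 1) /\
  (forall k n : nat, exists M : R, forall x, `|x| ^+ k * `|derive1n n f x| <= M).

Definition schwartz (R : realType) (g : R -> R[i]) : Prop :=
  schwartz_real (fun x => complex.Re (g x)) /\
  schwartz_real (fun x => complex.Im (g x)).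

Definition class_C2 (R : realType) (h : R -> R) : Prop :=
  [/\ forall x, derivable h x 1, forall x, derivable (derive1 h) x 1
    & continuous (derive1n 2 h)].

Definition ansatz (R : realType) (m h : R -> R) (C0 : R) (g : R -> R[i])
    (eps t : R) : field2 R := fun x =>
  let u := x.1 + h (eps * x.2) in
  let h' := derive1 h (eps * x.2) in
  ((chi m C0 u)%:C * g (- eps * h' * u + x.2 - t)) *:
    mk_spinor 1 ('i / 2%:R * (eps * h')%:C).

(* Main.v *)
(* The ansatz a(t) is built so that the residual i d_t a + D a contains only
   terms of size eps^2: the terms of size eps cancel because chi' = - m chi
   away from the countably many jumps of m. Each remaining term is
   eps^2 times a product of chi(u), a power of 1 + |u| and g or g' at the phase
   - eps h' u + x_2 - t, where u = x_1 + h(eps x_2). As chi decays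
   exponentially, Peetre's inequality bounds it by a multiple of
   1 / ((1 + |u|) (1 + |x_2 - t|)), whose L^2 norm does not depend on eps and t
   since (x_1, x_2) |-> (u, x_2) preserves the Lebesgue measure.
   The distance between the unitary evolution and a(t) then grows at most at
   the rate eps^2, by comparing U(d) a(t) with a(t + d) as d tends to 0.

   That a(t) lies in the domain H^1 is not immediate, because chi is not
   differentiable at the jumps of m. For F locally Lipschitz and a test function
   phi, the difference quotients of F phi have zero integral by translation
   invariance; by dominated convergence the a.e. derivative of F phi has zero
   integral, which is the integration by parts formula for F. *)

Require Import Defs.
From mathcomp Require Import all_boot all_order all_algebra.
From mathcomp Require Import all_classical all_reals all_analysis.
From mathcomp Require Import measurable_realfun ring lra.
Import Order.TTheory GRing.Theory Num.Theory.
Import numFieldNormedType.Exports.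
Local Open Scope classical_set_scope.
Local Open Scope ring_scope.

Set Implicit Arguments.
Unset Strict Implicit.
Unset Printing Implicit Defensive.

(** * Lebesgue measure on the plane *)

Section plane_measure.
Context {R : realType}.
Local Notation M2 := (measurableTypeR R * measurableTypeR R)%type.

(** The corrections in the ansatz are dictated by the order [eps]. Write [E] for [eps h'(eps x_2)].
    In the first equation the transport of [chi(u)] along [x_2] leaves [- i m E chi g]; since
    [(m - d_1) chi = 2 m chi], a second component [(i/2) E chi g] removes it. In the second equation
    the tilt [- E u] of the phase leaves [- E chi g'], and the time and [x_2] derivatives of that
    same second component give back [E chi g' / 2] each. One constant has to serve all [eps] and
    [t], so the decay of [chi] is condensed into a single bound before [eps] and [t] are fixed. The
    generator is known only through [L^2] limits of difference quotients, whose rate of convergence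
    depends on the vector. The two evolutions are therefore compared over finite increments, with an
    arbitrary slack [eta] in the growth rate; taking [eta = eps ^+ 2] only changes the constant. *)

Lemma open_measurable2 (U : set (R * R)) : open U ->
  measurable (U : set M2).
Proof.
move=> oU.
(* Boxes with rational corners form a countable base of the plane, so an open set is a countable
   union of measurable rectangles. A code that names no box, or a box not inside [U], contributes
   [set0]. *)
pose box (q : rat * rat * (rat * rat)) : set (R * R) :=
  `]ratr q.1.1, ratr q.1.2[ `*` `]ratr q.2.1, ratr q.2.2[.
pose G n := if unpickle n is Some q then
  if pselect (box q `<=` U) then box q else set0 else set0.
have -> : U = \bigcup_n G n.
  apply/seteqP; split => [[x y] Uxy|z [n _]]; last first.
    rewrite /G; case: unpickle => // q; by case: pselect => // sub /sub.
  move: oU; rewrite openE => /(_ _ Uxy)/nbhs_ballP[/= e e0 eU].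
  have rat_lt (a b : R) : a < b -> exists q : rat, a < ratr q < b.
    by move=> /rat_in_itvoo[q]; rewrite in_itv/= => ?; exists q.
  have [a /andP[a1 a2]] := rat_lt (x - e) x ltac:(lra).
  have [b /andP[b1 b2]] := rat_lt x (x + e) ltac:(lra).
  have [c /andP[c1 c2]] := rat_lt (y - e) y ltac:(lra).
  have [d /andP[d1 d2]] := rat_lt y (y + e) ltac:(lra).
  have sub : box ((a, b), (c, d)) `<=` U.
    move=> [x' y'] [/=]; rewrite !in_itv/= => /andP[? ?] /andP[? ?].
    by apply: eU; split; rewrite /ball/= ltr_norml; apply/andP; split; lra.
  have boxxy : box ((a, b), (c, d)) (x, y).
    by split => /=; rewrite in_itv/=; apply/andP; split.
  move: ((a, b), (c, d)) sub boxxy => q sub boxxy.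
  by exists (pickle q); [exact: I|rewrite /G pickleK; case: pselect].
apply: bigcup_measurable => n _; rewrite /G.
case: unpickle => [q|]; last exact: measurable0.
case: pselect => [?|?]; last exact: measurable0.
by apply: measurableX; exact: measurable_itv.
Qed.

Lemma continuous_measurable2 (f : R * R -> R) : continuous f ->
  measurable_fun (setT : set M2) (f : M2 -> measurableTypeR R).
Proof.
move=> /continuousP cf; apply: (measurability _ (RGenOpens.measurableE R)).
move=> _ [_ [a [b ->] <-]]; rewrite setTI; apply: open_measurable2.
exact/cf/interval_open.
Qed.

(** By uniqueness of the Lebesgue measure it suffices that translations preserve the length of the
    intervals []b, c]]. *)
Lemma lebesgue_measure_shift (a : R) (A : set (measurableTypeR R)) :
  measurable A ->
  pushforward (@lebesgue_measure R) ((fun x => x + a) : _ -> measurableTypeR R) A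
    = lebesgue_measure A.
Proof.
move=> mA; apply/esym/lebesgue_measure_unique => //=.
  exact: measurable_funD.
move=> ms _ [[b c] _ <-].
rewrite /pushforward (_ : _ @^-1` _ = `]b - a, c - a]%classic); last first.
  by apply/seteqP; split => x /=; rewrite !in_itv/= => /andP[? ?];
    apply/andP; split; lra.
rewrite !lebesgue_measure_itv/= !lte_fin ltrD2r; case: ifP => // _.
by rewrite -!EFinB; congr EFin; lra.
Qed.

Definition shift2 (v : R * R) : M2 -> M2 := fun x => (x.1 + v.1, x.2 + v.2).

Lemma measurable_shift2 (v : R * R) : measurable_fun setT (shift2 v).
Proof. by apply: measurable_fun_pair => /=; apply: measurable_funD. Qed.

Lemma leb2_shift (v : R * R) (A : set M2) : measurable A ->
  pushforward (leb2 R) (shift2 v) A = leb2 R A.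
Proof.
move=> mA; apply/esym/product_measure_unique => //=.
  exact: measurable_shift2.
move=> ms B C mB mC; rewrite /pushforward.
rewrite (_ : _ @^-1` _ =
  (((fun x => x + v.1) : _ -> measurableTypeR R) @^-1` B) `*`
  (((fun x => x + v.2) : _ -> measurableTypeR R) @^-1` C)) //.
rewrite product_measure1E.
- by congr (_ * _)%E; exact: lebesgue_measure_shift.
- by rewrite -[X in measurable X]setTI; apply: measurable_funD.
- by rewrite -[X in measurable X]setTI; apply: measurable_funD.
Qed.

Lemma Rintegral_shift2 (v : R * R) (f : R * R -> R) :
  (leb2 R).-integrable setT (EFin \o f) ->
  (leb2 R).-integrable setT (EFin \o (f \o shift2 v)) /\
  \int[leb2 R]_x (f (shift2 v x)) = \int[leb2 R]_x f x.
Proof.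
move=> intf.
(* The change of variables for a signed function presupposes that the composite is integrable; this
   comes first, from the nonnegative version applied to [|f|]. *)
have intfv : (leb2 R).-integrable setT (EFin \o (f \o shift2 v)).
  case/integrableP : intf => mf foo; apply/integrableP; split.
    exact: (measurableT_comp mf (measurable_shift2 v)).
  apply: le_lt_trans foo; rewrite le_eqVlt; apply/orP; left; apply/eqP.
  have := @ge0_integral_pushforward _ _ _ _ R _ (measurable_shift2 v) (leb2 R)
    setT (fun x => `|(EFin \o f) x|)%E measurableT.
  rewrite preimage_setT => E.
  have {}E := E (measurableT_comp (@abse_measurable R setT) mf).
  apply: etrans (esym (E _)) _; first by move=> y _; exact: abse_ge0.
  apply: eq_measure_integral; first exact: measurable_shift2.
  by move=> ms A mA _; exact: leb2_shift.
split => //; rewrite /Rintegral; congr fine.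
case/integrableP : (intf) => mf _.
have := @integral_pushforward _ _ _ _ R _ (measurable_shift2 v) (leb2 R)
  setT (EFin \o f) mf intfv measurableT.
rewrite preimage_setT => /esym E; apply: (etrans E).
apply: eq_measure_integral; first exact: measurable_shift2.
by move=> ms A mA _; exact: leb2_shift.
Qed.

End plane_measure.

(** * Weak derivatives of locally Lipschitz functions *)

Section vanishing_integral.
Context {R : realType}.
Local Notation M2 := (measurableTypeR R * measurableTypeR R)%type.

(** Dominated convergence runs along sequences, hence the derivative as a limit over a sequence of
    nonzero steps. *)
Lemma is_derive_cvg_seq (f : R -> R) (x d : R) (u : R^nat) :
  is_derive x 1 f d -> (forall n, u n != 0) -> u @ \oo --> 0 ->
  (u n)^-1 * (f (x + u n) - f x) @[n --> \oo] --> d.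
Proof.
move=> [df <-] u0 cu.
have {}df : h^-1 * (f (x + h) - f x) @[h --> 0^'] --> 'D_1 f x.
  move: df => /cvg_ex[l]; rewrite /derive /= => dl.
  have -> : lim (h^-1 *: (f (h *: 1 + x) - f x) @[h --> 0^']) = l.
    by apply/cvg_lim.
  move: dl; apply: cvg_trans; apply: near_eq_cvg; near=> h.
  have -> : h%:A = h :> R by exact: mulr1.
  by rewrite [h + x]addrC.
by move/cvgr_dnbhsP : df => /(_ u (conj u0 cu)).
Unshelve. all: by end_near. Qed.

Definition box (N : R) : set (R * R) := [set x | `|x.1| <= N /\ `|x.2| <= N].

Lemma measurable_box N : measurable (box N : set M2).
Proof.
rewrite (_ : box N = `[- N, N]%classic `*` `[- N, N]%classic).
  by apply: measurableX; exact: measurable_itv.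
by apply/seteqP; split => x; rewrite /box/= !in_itv/= !ler_norml.
Qed.

Lemma leb2_box_lty N : (leb2 R (box N) < +oo)%E.
Proof.
rewrite (_ : box N = `[- N, N]%classic `*` `[- N, N]%classic); last first.
  by apply/seteqP; split => x; rewrite /box/= !in_itv/= !ler_norml.
rewrite /leb2/= product_measure1E; [|exact: measurable_itv..].
have E : (@lebesgue_measure R `[(- N)%R, N]%classic < +oo)%E.
  by rewrite lebesgue_measure_itv/=; case: ifP => _ //; rewrite -EFinB ltry.
by apply: lte_mul_pinfty => //; rewrite ge0_fin_numE.
Qed.

Lemma integrable_box_cst N (k : R) :
  (leb2 R).-integrable setT (fun x : M2 => (k * \1_(box N) x)%:E).
Proof.
apply/integrableP; split.
  apply/measurable_EFinP; apply: measurable_funM => //.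
  by apply: measurable_indic; exact: measurable_box.
under eq_integral do rewrite abse_EFin normrM EFinM.
rewrite ge0_integralZl//.
- under eq_integral do rewrite ger0_norm//.
  rewrite integral_indic//=; last exact: measurable_box.
  by rewrite setIT lte_mul_pinfty// ?leb2_box_lty.
- apply/measurable_EFinP/measurableT_comp => //.
  by apply: measurable_indic; exact: measurable_box.
Qed.

Lemma integrable_box (N k : R) (f : R * R -> R) :
  measurable_fun (setT : set M2) f ->
  (forall x, `|f x| <= k * \1_(box N) x) ->
  (leb2 R).-integrable setT (EFin \o f).
Proof.
move=> mf fk; apply: (le_integrable _ _ _ (integrable_box_cst N k)) => //.
  exact/measurable_EFinP.
by move=> x _ /=; rewrite lee_fin (le_trans (fk x))// ler_norm.
Qed.

(** The bound on the values is bundled with the Lipschitz constant because a product of Lipschitz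
    functions is controlled only where both factors are bounded. The sum distance allows one
    coordinate to be moved at a time. *)
Definition lipbox (N : R) (H : R * R -> R) := exists2 K : R, 0 <= K &
  (forall x, box N x -> `|H x| <= K) /\
  (forall x y, box N x -> box N y ->
     `|H x - H y| <= K * (`|x.1 - y.1| + `|x.2 - y.2|)).

(* The difference quotients of [H] have zero integral by translation
   invariance, and they are dominated by the Lipschitz constant of [H] on a
   box. *)
Lemma integral_derive0 (e : R * R) (N : R) (H D : R * R -> R) :
  `|e.1| + `|e.2| <= 1 ->
  measurable_fun (setT : set M2) H -> measurable_fun (setT : set M2) D ->
  (forall x, ~ box N x -> H x = 0) ->
  lipbox (N + 1) H ->
  {ae leb2 R, forall x, is_derive (0 : R) (1 : R)
    (fun s => H (x.1 + s * e.1, x.2 + s * e.2)) (D x)} ->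
  (leb2 R).-integrable setT (EFin \o D) /\ \int[leb2 R]_x D x = 0.
Proof.
(* Type class inference does not find this instance through [leb2]. *)
have aeF := ae_filter_ringOfSetsType (leb2 R).
move=> e1 mH mD H0 [K K0 [HK HL]] HD.
pose v n : R * R := (harmonic n * e.1, harmonic n * e.2).
pose f_ n x := n.+1%:R * (H (shift2 (v n) x) - H x).
have hn n : 0 < (harmonic n : R) <= 1.
  by rewrite harmonic_gt0/= /harmonic invf_le1// ler1n.
have vn n : `|(v n).1| + `|(v n).2| <= harmonic n.
  have /andP[? ?] := hn n.
  rewrite /v /= !normrM -mulrDr ger0_norm ?ler_piMr//; exact: ltW.
have v1 n : `|(v n).1| + `|(v n).2| <= 1.
  by rewrite (le_trans (vn n))//; have /andP[] := hn n.
have ms n : measurable_fun setT (shift2 (v n)) by exact: measurable_shift2.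
have mHs n : measurable_fun (setT : set M2) (H \o shift2 (v n)).
  exact: (measurableT_comp mH (ms n)).
have mf n : measurable_fun (setT : set M2) (f_ n).
  apply: measurable_funM; first exact: measurable_cst.
  by apply: measurable_funB; [exact: mHs|exact: mH].
have boxS x (w : R * R) (M : R) : box M x -> `|w.1| + `|w.2| <= 1 ->
    box (M + 1) (shift2 w x).
  move=> [x1 x2] w1; rewrite /box/shift2/=; split.
    by rewrite (le_trans (ler_normD _ _))// lerD//; have := normr_ge0 w.2; lra.
  by rewrite (le_trans (ler_normD _ _))// lerD//; have := normr_ge0 w.1; lra.
have boxW x : box N x -> box (N + 1) x.
  by move=> [x1 x2]; split; lra.
have fK n x : `|f_ n x| <= K * \1_(box (N + 1)) x.
  have [xN|xN] := pselect (box N x \/ box N (shift2 (v n) x)); last first.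
    rewrite /f_ !H0; [|by move=> ?; apply: xN; [left]..|]; last first.
      by move=> ?; apply: xN; right.
    by rewrite subrr mulr0 normr0 mulr_ge0.
  have [xN1 xN2] : box (N + 1) x /\ box (N + 1) (shift2 (v n) x).
    case: xN => xN; split; try exact: boxW; first exact: boxS.
    have -> : x = shift2 (- (v n).1, - (v n).2) (shift2 (v n) x).
      by rewrite /shift2/= !addrK; case: x {xN}.
    by apply: boxS => //=; rewrite !normrN; exact: v1.
  rewrite indicE mem_set// mulr1 /f_ normrM normr_nat.
  rewrite -ler_pdivlMl// (le_trans (HL _ _ xN2 xN1))//.
  rewrite /shift2/= [_ + _ - x.1]addrC addKr [_ + _ - x.2]addrC addKr.
  by rewrite [leRHS]mulrC ler_wpM2l//; exact: vn.
have intH : (leb2 R).-integrable setT (EFin \o H).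
  apply: (integrable_box (N := N) (k := K)) => // x.
  have [xN|xN] := pselect (box N x).
    by rewrite indicE mem_set// mulr1 HK//; exact: boxW.
  by rewrite H0// normr0 mulr_ge0.
have intf n : \int[leb2 R]_x f_ n x = 0.
  have [iH EH] := Rintegral_shift2 (v n) intH.
  rewrite RintegralZl//=; last first.
    under [X in integrable _ _ X]funext => x do rewrite /= EFinB.
    exact: integrableB.
  by rewrite RintegralB// EH subrr mulr0.
have [|||||iD _] := @dominated_convergence _ _ R (leb2 R) setT measurableT
  (fun n => EFin \o f_ n) (EFin \o D) (fun x => (K * \1_(box (N + 1)) x)%:E).
- by move=> n; apply/measurable_EFinP.
- exact/measurable_EFinP.
- move: HD; apply: filterS => x Dx _ /=; apply/fine_cvgP; split; first exact: nearW.
  rewrite /=.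
  have := is_derive_cvg_seq Dx (u := @harmonic R).
  move=> /(_ (fun n => lt0r_neq0 (harmonic_gt0 n)) cvg_harmonic).
  apply: cvg_trans; apply: near_eq_cvg; apply: nearW => n /=.
  by rewrite /f_ /shift2/= !add0r /harmonic invrK !mul0r !addr0; case: x {Dx}.
- exact: integrable_box_cst.
- by apply: aeW => x n _ /=; rewrite lee_fin.
move=> cD; split => //.
have intf0 n : (\int[leb2 R]_x (EFin \o f_ n) x = 0)%E.
  rewrite -[LHS]fineK; first by congr EFin; exact: intf.
  by apply: integrable_fin_num => //; exact: (integrable_box (mf n) (fK n)).
have {}cD : ((fun _ : nat => 0) @ \oo --> \int[leb2 R]_x (EFin \o D) x)%E.
  move: cD; apply: cvg_trans; apply: near_eq_cvg; apply: nearW => n /=.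
  exact: intf0.
have E : (\int[leb2 R]_x (EFin \o D) x = 0)%E.
  by apply: (@cvg_unique _ (@ereal_hausdorff R) _ _ _ _ cD); exact: cvg_cst.
by rewrite /Rintegral; have -> := E.
Qed.

End vanishing_integral.

Section lipschitz_functions.
Context {R : realType}.
Local Notation der x f d := (is_derive (x : R) (1 : R) (f : R -> R) (d : R)).

Lemma derM (f g : R -> R) x a b : der x f a -> der x g b ->
  der x (fun s => f s * g s) (a * g x + f x * b).
Proof.
move=> fa gb; have := is_deriveM fa gb.
by move/is_derive_eq; apply; rewrite /GRing.scale/= addrC [g x * _]mulrC.
Qed.

Lemma derD (f g : R -> R) x a b : der x f a -> der x g b ->
  der x (fun s => f s + g s) (a + b).
Proof. by move=> fa gb; exact: is_deriveD fa gb. Qed.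

Lemma der_comp (q f : R -> R) x a b : der (f x) q b -> der x f a ->
  der x (fun s => q (f s)) (b * a).
Proof. by move=> qb fa; exact: is_derive1_comp qb fa. Qed.

Lemma der_cst (k x : R) : der x (fun=> k) 0.
Proof. exact: is_derive_cst. Qed.

Lemma der_id (x : R) : der x (fun s => s) 1.
Proof. exact: is_derive_id. Qed.

Lemma der_shift0 (f : R -> R) x d : der x f d -> der 0 (fun s => f (x + s)) d.
Proof.
move=> fd; have := @der_comp f (fun s => x + s) 0 (0 + 1) d.
rewrite addr0 add0r mulr1; apply => //.
by have := derD (der_cst x 0) (der_id 0); rewrite add0r.
Qed.

(** The mean value theorem, with [a] and [b] in either order. The bound on the derivative is asked
    only between them: it is later available only on a half-line or near a point. *)
Lemma der_lip (f f' : R -> R) (K a b : R) :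
  (forall s, Num.min a b <= s <= Num.max a b -> der s f (f' s) /\ `|f' s| <= K) ->
  `|f a - f b| <= K * `|a - b|.
Proof.
have main (c d : R) : c <= d ->
    (forall s, c <= s <= d -> der s f (f' s) /\ `|f' s| <= K) ->
    `|f d - f c| <= K * `|d - c|.
  move=> cd H.
  have [||s] := @MVT_segment R f f' c d cd.
  - move=> s; rewrite in_itv/= => /andP[? ?]; apply: (H s _).1; by rewrite !ltW.
  - apply: derivable_within_continuous => s; rewrite in_itv/= => sab.
    by have [[]] := H s sab.
  rewrite in_itv/= => /H[_ sK] ->.
  by rewrite normrM ler_wpM2r.
move=> H; have [ab|/ltW ba] := leP a b.
  rewrite distrC [`|a - b|]distrC; apply: main => // s sab; apply: H.
  by rewrite min_l// max_r.
by apply: main => // s sab; apply: H; rewrite min_r// max_l.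
Qed.

Lemma continuous_bounded_box (f : R * R -> R) (N : R) : continuous f ->
  exists2 K : R, 0 <= K & forall x, box N x -> `|f x| <= K.
Proof.
move=> cf.
have boxE : box N = `[- N, N]%classic `*` `[- N, N]%classic.
  by apply/seteqP; split => x; rewrite /box/= !in_itv/= !ler_norml.
have /compact_bounded bf : compact (f @` box N).
  apply: continuous_compact; first exact: continuous_subspaceT.
  by rewrite boxE; apply: compact_setX; exact: segment_compact.
have [K K0 HK] := pinfty_ex_gt0 bf.
by exists K; [exact: ltW|move=> x xN; apply: HK; exists x].
Qed.

Lemma lipbox_cst N k : lipbox N (fun=> k : R).
Proof.
exists `|k| => //; split => // x y _ _; rewrite subrr normr0.
by rewrite mulr_ge0// addr_ge0.
Qed.

Lemma lipbox_fst N : lipbox N (fun x => x.1 : R).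
Proof.
exists (Num.max 1 N); first by rewrite le_max ler01.
split => [x [x1 _]|x y _ _]; first by rewrite le_max x1 orbT.
have : `|x.1 - y.1| <= `|x.1 - y.1| + `|x.2 - y.2| by rewrite lerDl.
by move/le_trans; apply; rewrite ler_peMl ?addr_ge0// le_max lexx.
Qed.

Lemma lipbox_snd N : lipbox N (fun x => x.2 : R).
Proof.
exists (Num.max 1 N); first by rewrite le_max ler01.
split => [x [_ x2]|x y _ _]; first by rewrite le_max x2 orbT.
have : `|x.2 - y.2| <= `|x.1 - y.1| + `|x.2 - y.2| by rewrite lerDr.
by move/le_trans; apply; rewrite ler_peMl ?addr_ge0// le_max lexx.
Qed.

Lemma lipboxD N (F G : R * R -> R) : lipbox N F -> lipbox N G ->
  lipbox N (fun x => F x + G x).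
Proof.
move=> [K K0 [FK FL]] [L L0 [GK GL]]; exists (K + L); first exact: addr_ge0.
split=> [x xN|x y xN yN].
  by rewrite (le_trans (ler_normD _ _))// lerD ?FK ?GK.
rewrite opprD addrACA (le_trans (ler_normD _ _))// mulrDl.
by rewrite lerD ?FL ?GL.
Qed.

Lemma lipboxM N (F G : R * R -> R) : lipbox N F -> lipbox N G ->
  lipbox N (fun x => F x * G x).
Proof.
move=> [K K0 [FK FL]] [L L0 [GK GL]]; exists (2 * K * L).
  by rewrite !mulr_ge0.
split=> [x xN|x y xN yN].
  have := FK _ xN; have := GK _ xN => ? ?.
  rewrite normrM (le_trans (ler_pM _ _ (FK _ xN) (GK _ xN)))//.
  by rewrite -mulrA ler_peMl// ?mulr_ge0// ler1n.
have -> : F x * G x - F y * G y = F x * (G x - G y) + (F x - F y) * G y by ring.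
rewrite (le_trans (ler_normD _ _))// !normrM.
set d := `|_| + `|_|.
have -> : 2 * K * L * d = K * (L * d) + (K * d) * L by ring.
by rewrite lerD// ler_pM ?FK ?GK ?FL ?GL.
Qed.

Lemma lipbox_comp N (K : R) (q : R -> R) (F : R * R -> R) :
  (forall a b, `|q a - q b| <= K * `|a - b|) -> lipbox N F ->
  lipbox N (fun x => q (F x)).
Proof.
move=> qK [L L0 [FK FL]].
have K0 : 0 <= K.
  by have := le_trans (normr_ge0 _) (qK 1 0); rewrite subr0 normr1 mulr1.
exists (`|q 0| + K * L); first by rewrite addr_ge0// mulr_ge0.
split=> [x xN|x y xN yN].
  have -> : q (F x) = q 0 + (q (F x) - q 0) by ring.
  rewrite (le_trans (ler_normD _ _))// lerD// (le_trans (qK _ _))//.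
  by rewrite subr0 ler_wpM2l// FK.
rewrite (le_trans (qK _ _))// mulrDl -mulrA -[leLHS]add0r.
by rewrite lerD ?mulr_ge0 ?addr_ge0 ?ler_wpM2l ?FL.
Qed.

Lemma test_function_props (phi : R * R -> R) : test_function phi ->
  [/\ continuous phi, continuous (partial1 phi), continuous (partial2 phi),
      forall x, der x.1 (fun s => phi (s, x.2)) (partial1 phi x) &
      forall x, der x.2 (fun s => phi (x.1, s)) (partial2 phi x)] /\
  exists2 N : R, 0 <= N & forall x, ~ box N x -> phi x = 0.
Proof.
move=> [cphi supp]; have [c0 [d1 d2 [c1 _] [c2 _]]] := cphi 1%N.
split.
  split; [exact: c0|exact: c1|exact: c2|move=> x..].
    by rewrite /partial1 derive1E; exact: derivableP.
  by rewrite /partial2 derive1E; exact: derivableP.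
have [K K0 HK] := pinfty_ex_gt0 (compact_bounded supp).
exists K; first exact: ltW.
move=> x xN; have [//|phix] := eqVneq (phi x) 0.
exfalso; apply: xN; have /HK : closure [set x | phi x != 0] x.
  exact: subset_closure.
rewrite /= prod_normE/= ge_max => /andP[? ?].
by split.
Qed.

Lemma test_function_lipbox (phi : R * R -> R) N : test_function phi ->
  lipbox N phi.
Proof.
move=> /test_function_props[[c0 c1 c2 d1 d2] _].
have [K0 K00 HK0] := continuous_bounded_box N c0.
have [K1 K10 HK1] := continuous_bounded_box N c1.
have [K2 K20 HK2] := continuous_bounded_box N c2.
exists (K0 + K1 + K2); first by rewrite !addr_ge0.
split=> [x xN|x y [x1 x2] [y1 y2]].
  by rewrite (le_trans (HK0 _ xN))// -addrA lerDl addr_ge0.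
have mid (a b s : R) : `|a| <= N -> `|b| <= N ->
    Num.min a b <= s <= Num.max a b -> `|s| <= N.
  by rewrite !ler_norml ge_min le_max => /andP[? ?] /andP[? ?] /andP[/orP[]? /orP[]?];
    apply/andP; split; lra.
(* The path from [x] to [y] follows two axis-parallel segments with corner [(y.1, x.2)], which stay
   inside the box. *)
have -> : phi x - phi y = (phi (x.1, x.2) - phi (y.1, x.2)) +
   (phi (y.1, x.2) - phi (y.1, y.2)) by case: x {x1 x2} => ? ?; case: y {y1 y2} => ? ? /=; ring.
rewrite (le_trans (ler_normD _ _))// mulrDr lerD//.
  apply: (@le_trans _ _ (K1 * `|x.1 - y.1|)); last first.
    by rewrite ler_wpM2r//; lra.
  apply: (@der_lip (fun s => phi (s, x.2)) (fun s => partial1 phi (s, x.2))) => // s smid.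
  split; first exact: (d1 (s, x.2)).
  by apply: HK1; split => //=; exact: mid smid.
apply: (@le_trans _ _ (K2 * `|x.2 - y.2|)); last first.
  by rewrite ler_wpM2r//; lra.
apply: (@der_lip (fun s => phi (y.1, s)) (fun s => partial2 phi (y.1, s))) => // s smid.
split; first exact: (d2 (y.1, s)).
by apply: HK2; split => //=; exact: mid smid.
Qed.

End lipschitz_functions.

Section weak_derivatives.
Context {R : realType}.
Local Notation M2 := (measurableTypeR R * measurableTypeR R)%type.
Local Notation der x f d := (is_derive (x : R) (1 : R) (f : R -> R) (d : R)).

(** The direction [e] stands for either coordinate vector, so one argument covers both partial
    derivatives. Local boundedness of [D] makes [D * phi] integrable, which is needed to split the
    vanishing integral of the product rule. *)
Lemma weak_derivative_ae (e : R * R) (pd : (R * R -> R) -> R * R -> R)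
    (F D : R * R -> R) :
  `|e.1| + `|e.2| <= 1 ->
  (forall phi, test_function phi -> continuous (pd phi) /\
    forall x, der 0 (fun s => phi (x.1 + s * e.1, x.2 + s * e.2)) (pd phi x)) ->
  measurable_fun (setT : set M2) F -> measurable_fun (setT : set M2) D ->
  (forall N, lipbox N F) ->
  (forall N, exists K : R, forall x, box N x -> `|D x| <= K) ->
  {ae leb2 R, forall x, der 0 (fun s => F (x.1 + s * e.1, x.2 + s * e.2)) (D x)} ->
  weak_derivative pd F D.
Proof.
have aeF := ae_filter_ringOfSetsType (leb2 R).
move=> e1 pdP mF mD lipF bD derF phi tphi.
have [cpd dpd] := pdP _ tphi.
have [[cphi _ _ _ _] [N N0 supp]] := test_function_props tphi.
have mphi := continuous_measurable2 cphi.
have mpd := continuous_measurable2 cpd.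
have [K HK] := bD N.
have [L L0 HL] := continuous_bounded_box N cphi.
have mDphi : measurable_fun (setT : set M2) (fun x => D x * phi x).
  by apply: measurable_funM; [exact: mD|exact: mphi].
have mFpd : measurable_fun (setT : set M2) (fun x => F x * pd phi x).
  by apply: measurable_funM; [exact: mF|exact: mpd].
have iDphi : (leb2 R).-integrable setT (EFin \o (fun x => D x * phi x)).
  apply: (@integrable_box _ N (K * L)) => // x.
  have [xN|xN] := pselect (box N x).
    rewrite indicE mem_set// mulr1 normrM; apply: ler_pM => //; [exact: HK|exact: HL].
  by rewrite supp// mulr0 normr0 indicE memNset// mulr0.
have [|||||iS S0] := @integral_derive0 R e N (fun x => F x * phi x)
   (fun x => D x * phi x + F x * pd phi x) e1.
- by apply: measurable_funM; [exact: mF|exact: mphi].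
- by apply: measurable_funD; [exact: mDphi|exact: mFpd].
- by move=> x xN; rewrite supp// mulr0.
- by apply: lipboxM => //; exact: test_function_lipbox.
- move: derF; apply: filterS => x dF.
  have := derM dF (dpd x).
  by rewrite !mul0r !addr0; case: x {dF}.
(* Obtained as a difference of two integrable functions, which avoids a discussion of the support of
   [pd phi]. *)
have iFpd : (leb2 R).-integrable setT (EFin \o (fun x => F x * pd phi x)).
  have := integrableB measurableT iS iDphi.
  congr integrable; apply/funext => x /=; rewrite -EFinB; congr EFin; ring.
apply/eqP; rewrite -addr_eq0 addrC -RintegralD//; exact/eqP.
Qed.

Lemma weak_derivative1 (F D : R * R -> R) :
  measurable_fun (setT : set M2) F -> measurable_fun (setT : set M2) D ->
  (forall N, lipbox N F) ->
  (forall N, exists K : R, forall x, box N x -> `|D x| <= K) ->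
  {ae leb2 R, forall x, der x.1 (fun s => F (s, x.2)) (D x)} ->
  weak_derivative (@partial1 R) F D.
Proof.
have aeF := ae_filter_ringOfSetsType (leb2 R).
move=> mF mD lipF bD derF.
have shiftE (G : R * R -> R) x d : der x.1 (fun s => G (s, x.2)) d ->
    der 0 (fun s => G (x.1 + s * 1, x.2 + s * 0)) d.
  move/der_shift0; congr is_derive; apply/funext => s.
  by rewrite mulr1 mulr0 addr0.
apply: (@weak_derivative_ae (1, 0)) => //=.
- by rewrite normr1 normr0 addr0.
- move=> phi /test_function_props[[_ c1 _ d1 _] _]; split => // x.
  by apply: shiftE; exact: d1.
- by move: derF; apply: filterS => x /shiftE.
Qed.

Lemma weak_derivative2 (F D : R * R -> R) :
  measurable_fun (setT : set M2) F -> measurable_fun (setT : set M2) D ->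
  (forall N, lipbox N F) ->
  (forall N, exists K : R, forall x, box N x -> `|D x| <= K) ->
  {ae leb2 R, forall x, der x.2 (fun s => F (x.1, s)) (D x)} ->
  weak_derivative (@partial2 R) F D.
Proof.
have aeF := ae_filter_ringOfSetsType (leb2 R).
move=> mF mD lipF bD derF.
have shiftE (G : R * R -> R) x d : der x.2 (fun s => G (x.1, s)) d ->
    der 0 (fun s => G (x.1 + s * 0, x.2 + s * 1)) d.
  move/der_shift0; congr is_derive; apply/funext => s.
  by rewrite mulr1 mulr0 addr0.
apply: (@weak_derivative_ae (0, 1)) => //=.
- by rewrite normr1 normr0 add0r.
- move=> phi /test_function_props[[_ _ c2 _ d2] _]; split => // x.
  by apply: shiftE; exact: d2.
- by move: derF; apply: filterS => x /shiftE.
Qed.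

(** * Integration along a shear of the plane *)

Lemma ge0_integral_shift (f : R -> \bar R) (a : R) :
  measurable_fun setT f -> (forall x, 0 <= f x)%E ->
  (\int[@lebesgue_measure R]_x f (x + a)%R = \int[@lebesgue_measure R]_x f x)%E.
Proof.
move=> mf f0.
have ms : measurable_fun setT ((fun x => x + a) : _ -> measurableTypeR R).
  exact: measurable_funD.
have := @ge0_integral_pushforward _ _ (measurableTypeR R) (measurableTypeR R) R _
  ms (@lebesgue_measure R) setT f measurableT mf.
rewrite preimage_setT => E; apply: etrans (esym (E _)) _ => //.
by apply: eq_measure_integral => A mA _; exact: lebesgue_measure_shift.
Qed.

(** By Tonelli, with the integral in [x.1] taken first: for fixed [x.2] the shear is a translation
    of the line. *)
Lemma integral_shear (f w k : R -> R) :
  measurable_fun setT f -> measurable_fun setT w -> measurable_fun setT k ->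
  (forall x, 0 <= f x) -> (forall x, 0 <= w x) ->
  (\int[leb2 R]_x (f (x.1 + k x.2) * w x.2)%:E =
   (\int[@lebesgue_measure R]_x (f x)%:E) *
   \int[@lebesgue_measure R]_y (w y)%:E)%E.
Proof.
move=> mf mw mk f0 w0.
have mfk : measurable_fun (setT : set M2) (fun x : M2 => f (x.1 + k x.2)).
  apply: (measurableT_comp mf); apply: measurable_funD; first exact: measurable_fst.
  by apply: (measurableT_comp mk); exact: measurable_snd.
have mG : measurable_fun (setT : set M2)
    (fun x : M2 => (f (x.1 + k x.2) * w x.2)%:E).
  apply/measurable_EFinP; apply: measurable_funM => //.
  by apply: (measurableT_comp mw); exact: measurable_snd.
rewrite fubini_tonelli2//=; last by move=> x; rewrite lee_fin mulr_ge0.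
rewrite -ge0_integralZl//; last 3 first.
- exact/measurable_EFinP.
- by move=> x _; rewrite lee_fin.
- by apply: integral_ge0 => x _; rewrite lee_fin.
apply: eq_integral => y _; rewrite /fubini_G.
under eq_integral do rewrite EFinM.
suff E : (\int[@lebesgue_measure R]_x ((f (x + k y))%:E * (w y)%:E) =
  \int[@lebesgue_measure R]_x (f x)%:E * (w y)%:E)%E by exact: E.
rewrite ge0_integralZr//; last 3 first.
- apply/measurable_EFinP; apply: (measurableT_comp mf).
  exact: measurable_funD.
- by move=> x _; rewrite lee_fin.
- by rewrite lee_fin.
congr (_ * _)%E.
apply: (@ge0_integral_shift (EFin \o f)) => [|x]; first exact/measurable_EFinP.
by rewrite lee_fin.
Qed.

(** With [S] the set of jumps of [m], this makes the ansatz classically differentiable almost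
    everywhere in the plane. *)
Lemma ae_shear_notin (S : set R) (k : R -> R) : countable S ->
  measurable_fun setT k -> {ae leb2 R, forall x : R * R, ~ S (x.1 + k x.2)}.
Proof.
move=> cS mk; pose A : set M2 := [set x | S (x.1 + k x.2)].
have mS : measurable (S : set (measurableTypeR R)).
  by apply: countable_measurable => // x; exact: measurable_set1.
have mA : measurable A.
  rewrite -[A]setTI; apply: (_ : measurable_fun setT (fun x : M2 => x.1 + k x.2)) => //.
  apply: measurable_funD; first exact: measurable_fst.
  by apply: (measurableT_comp mk); exact: measurable_snd.
exists A; split => //; last by move=> x /= /contrapT.
have S0 : (\int[@lebesgue_measure R]_x (\1_S x)%:E = 0)%E.
  by rewrite integral_indic// setIT; exact: countable_lebesgue_measure0.
(* The weight [cst 1] has infinite integral; the product is still zero because [0 * +oo = 0] in the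
   extended reals. *)
have := @integral_shear \1_S (cst 1) k (measurable_indic mS) (measurable_cst _)
  mk (fun _ => ler0n _ _) (fun=> ler01).
rewrite S0 mul0e => E; rewrite -[LHS](_ : \int[leb2 R]_x (\1_A x)%:E = _)%E.
  by rewrite -[RHS]E; apply: eq_integral => x _ /=; rewrite mulr1.
by rewrite integral_indic// setIT.
Qed.

End weak_derivatives.

(** * The primitive of a domain wall *)

Section wall_primitive.
Context {R : realType}.
Local Notation mu := (@lebesgue_measure R).
Local Notation der x f d := (is_derive (x : R) (1 : R) (f : R -> R) (d : R)).

Section primitive.
Variables (m : R -> R).
Hypothesis mono : {homo m : x y / x <= y}.
Hypothesis mm : measurable_fun setT m.

Lemma integrable_cst_itv (k a b : R) :
  mu.-integrable `[a, b] (EFin \o (fun=> k)).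
Proof.
have ab_lty : (mu [set` `[a, b]%R] < +oo)%E.
  by rewrite lebesgue_measure_itv/=; case: ifP => _ //; rewrite -EFinB ltry.
apply/integrableP; split; first exact: measurable_cst.
under eq_integral do rewrite /=.
rewrite integral_cst; last exact: measurable_itv.
exact: lte_mul_pinfty.
Qed.

Lemma integrable_mono (a b : R) : mu.-integrable `[a, b] (EFin \o m).
Proof.
apply: (le_integrable _ _ _ (integrable_cst_itv (`|m a| + `|m b|) a b)) => //.
  by apply/measurable_EFinP; exact: measurable_funS mm.
move=> x /=; rewrite in_itv/= => /andP[ax xb]; rewrite lee_fin.
rewrite [leRHS]ger0_norm ?addr_ge0// ler_norml.
have := mono ax; have := mono xb.
have := ler_norm (m b); have := lerNnormlW (lexx `|m a|).
have := normr_ge0 (m a); have := normr_ge0 (m b).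
by move=> *; apply/andP; split; lra.
Qed.

Let I a b := \int[mu]_(x in `[a, b]) m x.

Lemma Rintegral_cst_itv (k a b : R) : a <= b ->
  \int[mu]_(x in `[a, b]) k = k * (b - a).
Proof.
move=> ab; rewrite Rintegral_cst//= lebesgue_measure_itv/= lte_fin.
move: ab; rewrite le_eqVlt => /predU1P[->|->]; first by rewrite ltxx subrr.
by rewrite -EFinB.
Qed.

Lemma Rintegral_itv_chasles a b c : a <= b -> b <= c -> I a c = I a b + I b c.
Proof.
move=> ab bc; apply/eqP; rewrite addrC -subr_eq; apply/eqP.
rewrite /I Rintegral_itvB ?bnd_simp//; last exact: integrable_mono.
rewrite Rintegral_itv_obnd_cbnd//.
by apply: integrableS (integrable_mono b c) => //; apply: subset_itvr; rewrite bnd_simp.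
Qed.

Lemma Rintegral_mono_bounds a b : a <= b -> m a * (b - a) <= I a b <= m b * (b - a).
Proof.
move=> ab; rewrite -!(Rintegral_cst_itv _ ab); apply/andP; split.
- apply: le_Rintegral => //; [exact: integrable_cst_itv|exact: integrable_mono|].
  by move=> x /=; rewrite in_itv/= => /andP[? _]; exact: mono.
- apply: le_Rintegral => //; [exact: integrable_mono|exact: integrable_cst_itv|].
  by move=> x /=; rewrite in_itv/= => /andP[_ ?]; exact: mono.
Qed.

(** The primitive of a monotone function is convex, and these are its subgradient inequalities. Its
    derivative, sign, growth and Lipschitz bound are all read off from them. *)
Lemma primitive0_bounds u v : u <= v ->
  m u * (v - u) <= primitive0 m v - primitive0 m u <= m v * (v - u).
Proof.
move=> uv; suff -> : primitive0 m v - primitive0 m u = I u v.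
  exact: Rintegral_mono_bounds.
rewrite /primitive0 -/(I 0 v) -/(I v 0) -/(I 0 u) -/(I u 0).
have [v0|v0] := leP 0 v; have [u0|u0] := leP 0 u.
- by rewrite (Rintegral_itv_chasles u0 uv) addrC addKr.
- by rewrite opprK (Rintegral_itv_chasles (ltW u0) v0) addrC.
- by move: (lt_le_trans v0 (le_trans u0 uv)); rewrite ltxx.
- by rewrite (Rintegral_itv_chasles uv (ltW v0)); ring.
Qed.

Lemma primitive00 : primitive0 m 0 = 0.
Proof. by rewrite /primitive0 lexx set_itv1 Rintegral_set1. Qed.

(** The difference quotient lies between the values of [m] at [u] and at [h + u], so continuity at
    the single point [u] is enough. *)
Lemma der_primitive0 u : {for u, continuous m} -> der u (primitive0 m) (m u).
Proof.
move=> cm.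
have key : h^-1 *: (primitive0 m (h *: 1 + u) - primitive0 m u) @[h --> 0^'] --> m u.
  apply/cvgrPdist_le => /= e e0.
  have /cvgrPdist_le/(_ e e0)/nbhs_ballP[d /= d0 dm] := cm.
  apply/nbhs_ballP; exists d => //= h; rewrite /ball/= sub0r normrN => hd h0.
  have -> : h%:A = h :> R by exact: mulr1.
  rewrite [_ *: _]/(h^-1 * _).
  have dm' s : `|s - u| <= `|h| -> `|m u - m s| <= e.
    by move=> su; apply: dm; rewrite /ball/= distrC (le_lt_trans su).
  have [hp|hn|hz] := ltgtP h 0; last by move: h0; rewrite hz eqxx.
  - have /primitive0_bounds/andP[b1 b2] : h + u <= u by lra.
    have := dm' (h + u); rewrite addrK lexx => /(_ isT).
    rewrite !ler_norml => /andP[d1 d2].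
    have -> : m u - h^-1 * (primitive0 m (h + u) - primitive0 m u) =
       (- h)^-1 * (m u * (- h) - (primitive0 m u - primitive0 m (h + u))).
      by field; rewrite h0.
    have hN : 0 < - h by rewrite oppr_gt0.
    by rewrite ler_pdivrMl// ler_pdivlMl// ; apply/andP; split; nra.
  - have /primitive0_bounds/andP[b1 b2] : u <= h + u by lra.
    have := dm' (h + u); rewrite addrK lexx => /(_ isT).
    rewrite !ler_norml => /andP[d1 d2].
    have -> : m u - h^-1 * (primitive0 m (h + u) - primitive0 m u) =
       h^-1 * (m u * h - (primitive0 m (h + u) - primitive0 m u)).
      by field; rewrite h0.
    by rewrite ler_pdivrMl// ler_pdivlMl// ; apply/andP; split; nra.
have dP : derivable (primitive0 m) u 1 by apply/cvg_ex; exists (m u).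
by apply: DeriveDef => //; apply/cvg_lim.
Qed.

End primitive.

(** A bound at every point, not merely almost everywhere: monotonicity places [m u] between values
    of [m] far out, which are within [1] of the limits. *)
Lemma domain_wall_bounded (m : R -> R) : domain_wall m ->
  exists2 M, 0 <= M & forall u, `|m u| <= M.
Proof.
move=> wm; have [l [l0 cp cn _ _]] := wall_limits wm.
exists (l + 1); first by lra.
move=> u; rewrite ler_norml; apply/andP; split.
- have : \forall v \near -oo, (- (l + 1) <= m v) /\ v <= u.
    near=> v; split; last by near: v; apply: nbhs_ninfty_le; exact: num_real.
    by apply: ltW; near: v; apply: (cvgr_gt _ cn); lra.
  move=> /filter_ex[v [mv vu]]; apply: (le_trans mv); exact: wall_monotone.
- have : \forall v \near +oo, (m v <= l + 1) /\ u <= v.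
    near=> v; split; last by near: v; apply: nbhs_pinfty_ge; exact: num_real.
    by apply: ltW; near: v; apply: (cvgr_lt _ cp); lra.
  move=> /filter_ex[v [mv vu]]; apply: (le_trans _ mv); exact: wall_monotone.
Unshelve. all: by end_near. Qed.

Lemma domain_wall_discontinuities (m : R -> R) : domain_wall m ->
  countable [set u | ~ {for u, continuous m}].
Proof.
move=> /wall_piecewise[fd _].
rewrite (_ : [set u | _] = \bigcup_(n : nat)
    [set x | - n%:R <= x <= n%:R /\ ~ {for x, continuous m}]).
  by apply: bigcup_countable => // n _; apply: finite_set_countable; exact: fd.
apply/seteqP; split => [u nu|u [n _ [_ nu]]//].
exists (Num.truncn `|u|).+1 => //; split => //.
by rewrite -ler_norml ltW// truncnS_gt.
Qed.

End wall_primitive.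

(** * Spinor fields in L^2 *)

Section spinor_norms.
Context {R : realType}.
Local Notation M2 := (measurableTypeR R * measurableTypeR R)%type.
Implicit Types (f g : field2 R) (v w : spinor R).

Lemma ReZ (c z : R[i]) : complex.Re (c * z) =
  complex.Re c * complex.Re z - complex.Im c * complex.Im z.
Proof. by case: c => ? ?; case: z. Qed.

Lemma ImZ (c z : R[i]) : complex.Im (c * z) =
  complex.Re c * complex.Im z + complex.Im c * complex.Re z.
Proof. by case: c => ? ?; case: z => ? ? /=; rewrite addrC. Qed.

Lemma ReD (z z' : R[i]) : complex.Re (z + z') = complex.Re z + complex.Re z'.
Proof. by case: z; case: z'. Qed.

Lemma ImD (z z' : R[i]) : complex.Im (z + z') = complex.Im z + complex.Im z'.
Proof. by case: z; case: z'. Qed.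

(** The Euclidean inner product of [R^4], with which [C^2] is identified through [reals]; its
    diagonal is the squared [spinor_norm]. *)
Definition dot4 (x y : R * R * (R * R)) : R :=
  x.1.1 * y.1.1 + x.1.2 * y.1.2 + x.2.1 * y.2.1 + x.2.2 * y.2.2.

Definition reals v : R * R * (R * R) :=
  ((complex.Re (v 0 0), complex.Im (v 0 0)),
   (complex.Re (v 1 0), complex.Im (v 1 0))).

Lemma spinor_normE v : spinor_norm v = Num.sqrt (dot4 (reals v) (reals v)).
Proof.
rewrite /spinor_norm big_ord_recl big_ord1 /dot4/=.
rewrite (_ : lift ord0 ord0 = 1 :> 'I_2); last exact/val_inj.
by congr Num.sqrt; rewrite -!expr2 !addrA.
Qed.

Lemma spinor_norm_ge0 v : 0 <= spinor_norm v.
Proof. exact: sqrtr_ge0. Qed.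

Lemma dot4_ge0 x : 0 <= dot4 x x.
Proof. by rewrite /dot4 -!expr2 !addr_ge0// sqr_ge0. Qed.

(* Lagrange's identity *)
Lemma dot4_cauchy x y : dot4 x y ^+ 2 <= dot4 x x * dot4 y y.
Proof.
case: x => [[a b] [c d]]; case: y => [[a' b'] [c' d']]; rewrite /dot4/= -subr_ge0.
rewrite (_ : _ - _ = (a * b' - b * a') ^+ 2 + (a * c' - c * a') ^+ 2
  + (a * d' - d * a') ^+ 2 + (b * c' - c * b') ^+ 2 + (b * d' - d * b') ^+ 2
  + (c * d' - d * c') ^+ 2); last by ring.
by rewrite !addr_ge0// sqr_ge0.
Qed.

Lemma reals_add v w : dot4 (reals (v + w)) (reals (v + w)) =
  dot4 (reals v) (reals v) + dot4 (reals w) (reals w)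
    + 2 * dot4 (reals v) (reals w).
Proof. by rewrite /reals /dot4/= !mxE !ReD !ImD; ring. Qed.

Lemma spinor_normD v w : spinor_norm (v + w) <= spinor_norm v + spinor_norm w.
Proof.
rewrite !spinor_normE -(@ler_pXn2r _ 2)// ?nnegrE ?addr_ge0 ?sqrtr_ge0//.
rewrite sqr_sqrtr ?dot4_ge0// reals_add sqrrD !sqr_sqrtr ?dot4_ge0//.
set X := dot4 _ _; set Y := dot4 _ _; set D := dot4 _ _.
suff : D <= Num.sqrt X * Num.sqrt Y by rewrite -mulr_natl; lra.
rewrite -sqrtrM ?dot4_ge0//; apply: (le_trans (ler_norm _)).
by rewrite -sqrtr_sqr ler_sqrt ?mulr_ge0 ?dot4_ge0//; exact: dot4_cauchy.
Qed.

Lemma spinor_normZ (c : R) v : spinor_norm (c%:C%C *: v) = `|c| * spinor_norm v.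
Proof.
rewrite !spinor_normE -sqrtr_sqr -sqrtrM ?sqr_ge0//; congr Num.sqrt.
by rewrite /reals /dot4/= !mxE !ReZ !ImZ /=; ring.
Qed.

Lemma spinor_norm_le v (k : R) :
  (forall j, `|complex.Re (v j 0)| <= k /\ `|complex.Im (v j 0)| <= k) ->
  spinor_norm v <= 2 * k.
Proof.
move=> H; have [a0 b0] := H 0; have [c0 d0] := H 1.
have k0 : 0 <= k := le_trans (normr_ge0 _) a0.
rewrite spinor_normE -(@ler_pXn2r _ 2)// ?nnegrE ?sqrtr_ge0 ?mulr_ge0//.
rewrite sqr_sqrtr ?dot4_ge0// exprMn /dot4/= -!expr2.
have sq (x : R) : `|x| <= k -> x ^+ 2 <= k ^+ 2.
  by move=> xk; rewrite -(real_normK (num_real x)) ler_pXn2r ?nnegrE.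
have := sq _ a0; have := sq _ b0; have := sq _ c0; have := sq _ d0; lra.
Qed.

Definition mspinor f :=
  (forall j, measurable_fun (setT : set M2) (fun x => complex.Re (f x j 0))) /\
  (forall j, measurable_fun (setT : set M2) (fun x => complex.Im (f x j 0))).

Lemma mspinorD f g : mspinor f -> mspinor g -> mspinor (fun x => f x + g x).
Proof.
move=> [fr fi] [gr gi]; split => j.
- under eq_fun do rewrite mxE ReD; apply: measurable_funD; [exact: fr|exact: gr].
- under eq_fun do rewrite mxE ImD; apply: measurable_funD; [exact: fi|exact: gi].
Qed.

Lemma mspinorZ (c : R[i]) f : mspinor f -> mspinor (fun x => c *: f x).
Proof.
move=> [fr fi]; split => j.
- under eq_fun do rewrite mxE ReZ.
  apply: measurable_funB; apply: measurable_funM; try exact: measurable_cst;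
    [exact: fr|exact: fi].
- under eq_fun do rewrite mxE ImZ.
  apply: measurable_funD; apply: measurable_funM; try exact: measurable_cst;
    [exact: fi|exact: fr].
Qed.

Lemma mspinorB f g : mspinor f -> mspinor g -> mspinor (fun x => f x - g x).
Proof.
move=> mf mg; have -> : (fun x => f x - g x) = (fun x => f x + (-1) *: g x).
  by apply/funext => x; rewrite scaleN1r.
by apply: mspinorD => //; exact: mspinorZ.
Qed.

Lemma in_L2_mspinor f : in_L2 f -> mspinor f.
Proof. by case. Qed.

Lemma measurable_spinor_norm f : mspinor f ->
  measurable_fun (setT : set M2) (fun x => spinor_norm (f x)).
Proof.
move=> [fr fi]; under eq_fun do rewrite spinor_normE.
apply: (measurableT_comp (continuous_measurable_fun (@sqrt_continuous R))).
by do ![apply: measurable_funD => //]; apply: measurable_funM => //;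
  do ?[exact: fr|exact: fi].
Qed.

Lemma L2normE f : L2norm f =
  ((\int[leb2 R]_x (spinor_norm (f x) ^+ 2)%:E) `^ 2^-1)%E.
Proof.
rewrite /L2norm unlock; congr (_ `^ _)%E; apply: eq_integral => x _ /=.
by rewrite ger0_norm ?spinor_norm_ge0// ?poweR_EFin powR_mulrn ?spinor_norm_ge0.
Qed.

Lemma L2norm_ge0 f : (0 <= L2norm f)%E.
Proof. exact: Lnorm_ge0. Qed.

Lemma L2norm_le f (g : R * R -> R) (B : R) : mspinor f -> 0 <= B ->
  measurable_fun (setT : set M2) g -> (forall x, spinor_norm (f x) <= g x) ->
  (\int[leb2 R]_x (g x ^+ 2)%:E <= (B ^+ 2)%:E)%E -> (L2norm f <= B%:E)%E.
Proof.
move=> mf B0 mg fg gB.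
have -> : B%:E = ((B ^+ 2)%:E `^ 2^-1)%E :> \bar R.
  by rewrite poweR_EFin powR12_sqrt ?sqr_ge0// sqrtr_sqr ger0_norm.
rewrite L2normE; apply: gt0_ler_poweR => //.
- rewrite in_itv/= leey andbT; apply: integral_ge0 => x _.
  by rewrite lee_fin sqr_ge0.
- by rewrite in_itv/= leey andbT lee_fin sqr_ge0.
apply: le_trans gB; apply: ge0_le_integral => //.
- by move=> x _; rewrite lee_fin sqr_ge0.
- apply/measurable_EFinP/measurable_funX; exact: measurable_spinor_norm.
- exact/measurable_EFinP/measurable_funX.
- move=> x _; rewrite lee_fin ler_pXn2r ?nnegrE//; first exact: spinor_norm_ge0.
  exact: le_trans (spinor_norm_ge0 _) (fg x).
Qed.

Lemma L2normD f g : mspinor f -> mspinor g ->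
  (L2norm (fun x => f x + g x)%R <= L2norm f + L2norm g)%E.
Proof.
move=> mf mg.
pose a x := spinor_norm (f x); pose b x := spinor_norm (g x).
apply: (@le_trans _ _ ('N[leb2 R]_2%:E[EFin \o (a \+ b)%R])%E); last first.
  by apply: minkowski_EFin => //; [exact: measurable_spinor_norm..|rewrite ler1n].
rewrite L2normE unlock; apply: gt0_ler_poweR => //.
- rewrite in_itv/= leey andbT; apply: integral_ge0 => x _.
  by rewrite lee_fin sqr_ge0.
- by rewrite in_itv/= leey andbT; apply: integral_ge0 => x _; rewrite lee_fin powR_ge0.
have ab0 x : 0 <= a x + b x by rewrite addr_ge0 ?spinor_norm_ge0.
have -> : (\int[leb2 R]_x `|(EFin \o (a \+ b)%R) x| `^ 2 =
    \int[leb2 R]_x ((a x + b x) ^+ 2)%:E)%E.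
  by apply: eq_integral => x _ /=; rewrite ger0_norm// ?poweR_EFin powR_mulrn.
apply: ge0_le_integral => //.
- by move=> x _; rewrite lee_fin sqr_ge0.
- apply/measurable_EFinP/measurable_funX; apply: measurable_spinor_norm.
  exact: mspinorD.
- apply/measurable_EFinP/measurable_funX.
  by apply: measurable_funD; exact: measurable_spinor_norm.
- move=> x _; rewrite lee_fin ler_pXn2r ?nnegrE ?spinor_norm_ge0//.
  exact: spinor_normD.
Qed.

Lemma L2normZ (c : R) f : mspinor f ->
  (L2norm (fun x => c%:C%C *: f x)%R = `|c|%:E * L2norm f)%E.
Proof.
move=> mf; rewrite !L2normE.
have -> : (\int[leb2 R]_x (spinor_norm (c%:C%C *: f x) ^+ 2)%:E =
    (c ^+ 2)%:E * \int[leb2 R]_x (spinor_norm (f x) ^+ 2)%:E)%E.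
  rewrite -ge0_integralZl//.
  - apply: eq_integral => x _.
    by rewrite spinor_normZ exprMn real_normK ?num_real// EFinM.
  - apply/measurable_EFinP/measurable_funX; exact: measurable_spinor_norm.
  - by move=> x _; rewrite lee_fin sqr_ge0.
  - by rewrite lee_fin sqr_ge0.
rewrite poweRM ?lee_fin ?sqr_ge0//; last first.
  by apply: integral_ge0 => x _; rewrite lee_fin sqr_ge0.
by rewrite poweR_EFin powR12_sqrt ?sqr_ge0// sqrtr_sqr.
Qed.

Lemma L2norm_ae f g : mspinor f -> mspinor g -> f = g %[ae leb2 R] ->
  L2norm f = L2norm g.
Proof.
have aeF := ae_filter_ringOfSetsType (leb2 R).
move=> mf mg fg; rewrite !L2normE; congr (_ `^ _)%E.
apply: ge0_ae_eq_integral => //.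
- apply/measurable_EFinP/measurable_funX; exact: measurable_spinor_norm.
- apply/measurable_EFinP/measurable_funX; exact: measurable_spinor_norm.
- by move=> x _; rewrite lee_fin sqr_ge0.
- by move=> x _; rewrite lee_fin sqr_ge0.
- by move: fg; apply: filterS => x /= ->.
Qed.

End spinor_norms.

(** * The edge profile and its decay *)

Section edge_profile.
Context {R : realType}.
Local Notation M2 := (measurableTypeR R * measurableTypeR R)%type.
Local Notation mu := (@lebesgue_measure R).
Local Notation der x f d := (is_derive (x : R) (1 : R) (f : R -> R) (d : R)).

Section chi.
Variables (m : R -> R) (C0 : R).
Hypotheses (wm : domain_wall m) (C0_gt0 : 0 < C0).
Local Notation P := (primitive0 m).
Local Notation X := (chi m C0).

Let bounds u v : u <= v -> m u * (v - u) <= P v - P u <= m v * (v - u).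
Proof. exact: (primitive0_bounds (wall_monotone wm) (wall_measurable wm)). Qed.

Let m0 : m 0 = 0. Proof. exact/(wall_zero wm). Qed.

Lemma primitive0_ge0 u : 0 <= P u.
Proof.
have P0 := primitive00 m.
have [u0|/ltW u0] := leP 0 u; have /andP[] := bounds u0; rewrite m0 P0; lra.
Qed.

(** As [m] is monotone and vanishes only at [0], it is at least [m 1 > 0] to the right of [1] and at
    most [m (-1) < 0] to the left of [-1]; [c] is the smaller slope. For [|u| <= 1] the lower bound
    is nonpositive. *)
Lemma primitive0_growth : exists2 c, 0 < c & forall u, c * (`|u| - 1) <= P u.
Proof.
have m1 : 0 < m 1.
  rewrite lt_neqAle -{2}m0 (wall_monotone wm)// andbT eq_sym.
  by apply/eqP => /(wall_zero wm)/eqP; rewrite oner_eq0.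
have mN1 : m (-1) < 0.
  rewrite lt_neqAle -{2}m0 (wall_monotone wm) ?lerN10// andbT.
  by apply/eqP => /(wall_zero wm)/eqP; rewrite oppr_eq0 oner_eq0.
pose c := Num.min (m 1) (- m (-1)).
have c1 : c <= m 1 by rewrite ge_min lexx.
have c2 : c <= - m (-1) by rewrite ge_min lexx orbT.
have c0 : 0 < c by rewrite lt_min m1 oppr_gt0.
exists c => // u.
have [u1|u1] := leP `|u| 1.
  by apply: le_trans (primitive0_ge0 u); nra.
have [u0|u0] := leP 0 u.
  move: u1; rewrite ger0_norm// => u1.
  have /andP[+ _] := bounds (ltW u1); have := primitive0_ge0 1; nra.
move: u1; rewrite ltr0_norm// => u1.
have uN1 : u <= -1 by lra.
have /andP[_ +] := bounds uN1; have := primitive0_ge0 (-1); nra.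
Qed.

Lemma chi_gt0 u : 0 < X u.
Proof. by rewrite mulr_gt0// expR_gt0. Qed.

(** The three powers are spent in [chi_weight]: one on the factor [1 + |u|] already present, one on
    the weight to be produced, one on Peetre's inequality. *)
Lemma chi_decay : exists2 K, 0 < K & forall u, X u * (1 + `|u|) ^+ 3 <= K.
Proof.
have [c c0 cP] := primitive0_growth.
(* Chosen so that [1 + s <= k * (1 + c * s / 3) <= k * expR (c * s / 3)], whose cube matches the
   decay rate [c]. *)
pose k := 1 + 3 / c.
have k0 : 0 < k by rewrite /k addr_gt0// divr_gt0.
exists (C0 * expR c * k ^+ 3).
  by rewrite !mulr_gt0// ?expR_gt0// exprn_gt0.
move=> u; set s := `|u|; have s0 : 0 <= s := normr_ge0 u.
have h1 : 1 + s <= k * expR (c * s / 3).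
  apply: (@le_trans _ _ (k * (1 + c * s / 3))); last first.
    by rewrite ler_wpM2l ?(ltW k0)// expR_ge1Dx.
  rewrite /k (_ : _ * _ = 1 + s + (3 / c + c * s / 3)); last by field; lra.
  by rewrite lerDl addr_ge0 ?divr_ge0 ?mulr_ge0// ltW.
have h3 : (1 + s) ^+ 3 <= k ^+ 3 * expR (c * s).
  have -> : expR (c * s) = expR (c * s / 3) ^+ 3.
    by rewrite -expRM_natl; congr expR; field.
  by rewrite -exprMn lerXn2r ?nnegrE ?addr_ge0// mulr_ge0 ?expR_ge0// ltW.
have h4 : X u <= C0 * expR (c - c * s).
  by rewrite /chi ler_pM2l// ler_expR; have := cP u; rewrite -/s; lra.
apply: (le_trans (ler_pM _ _ h4 h3)).
- exact/ltW/chi_gt0.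
- by rewrite exprn_ge0// addr_ge0.
rewrite [leLHS](_ : _ = C0 * k ^+ 3 * (expR (c - c * s) * expR (c * s))); last by ring.
by rewrite -expRD subrK [leLHS](_ : _ = C0 * expR c * k ^+ 3)//; ring.
Qed.

(** The primitive has Lipschitz constant [M] and is nonnegative, and [expR (- s)] has slope at most
    [1] in absolute value on [s >= 0]. *)
Lemma chi_lip : exists K, forall a b, `|X a - X b| <= K * `|a - b|.
Proof.
have [M M0 mM] := domain_wall_bounded wm.
exists (C0 * M) => a b.
have PM : `|P a - P b| <= M * `|a - b|.
  wlog ab : a b / a <= b.
    move=> H; have [/H//|/ltW/H] := leP a b.
    by rewrite distrC [`|b - a|]distrC.
  have /andP[b1 b2] := bounds ab.
  rewrite distrC [`|a - b|]distrC (ger0_norm (_ : 0 <= b - a)) ?subr_ge0//.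
  have := mM a; have := mM b; rewrite !ler_norml => /andP[? ?] /andP[? ?].
  by apply/andP; split; nra.
rewrite /chi -mulrBr normrM gtr0_norm// -mulrA ler_pM2l//.
apply: (le_trans _ PM); rewrite -[leRHS]mul1r.
apply: (@der_lip R (fun s => expR (- s)) (fun s => expR (- s) * -1)) => s /andP[sab _].
have s0 : 0 <= s by apply: le_trans sab; rewrite le_min !primitive0_ge0.
split.
  exact: (@der_comp R expR (fun s => - s)).
by rewrite mulrN1 normrN ger0_norm ?expR_ge0// -expR0 ler_expR oppr_le0.
Qed.

Lemma chi_der u : {for u, continuous m} -> der u X (- (m u * X u)).
Proof.
move=> cm; have dP := der_primitive0 (wall_monotone wm) (wall_measurable wm) cm.
have dE : der u (fun s => expR (- P s)) (expR (- P u) * - m u).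
  exact: (@der_comp R expR (fun s => - P s)).
have : der u X (0 * expR (- P u) + C0 * (expR (- P u) * - m u)).
  exact: derM (der_cst C0 u) dE.
by move/is_derive_eq; apply; rewrite /chi; ring.
Qed.

(* Peetre's inequality: one power of [1 + |u|], paid for by the decay of [chi],
   recentres at [y] a function decaying in [y + z]. *)
Lemma chi_weight (B : R) : 0 <= B -> exists2 K : R, 0 <= K &
  forall u y z v Cv : R, `|z| <= B * `|u| -> (1 + `|y + z|) * `|v| <= Cv ->
    X u * (1 + `|u|) * `|v| <= K * Cv * ((1 + `|u|) * (1 + `|y|))^-1.
Proof.
move=> B0; have [K K0 HK] := chi_decay.
exists (K * (1 + B)) => [|u y z v Cv zB vC].
  by rewrite mulr_ge0 ?addr_ge0// ltW.
have u0 := normr_ge0 u; have y0 := normr_ge0 y; have w0 := normr_ge0 (y + z).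
have z0 := normr_ge0 z; have v0 := normr_ge0 v.
rewrite ler_pdivlMr; last by rewrite mulr_gt0// ltr_wpDr.
have y1 : 1 + `|y| <= (1 + `|y + z|) * ((1 + B) * (1 + `|u|)).
  have : `|y| <= `|y + z| + `|z| by rewrite -[X in `|X| <= _](addrK z) ler_normB.
  move: zB; nra.
move: (X u) (ltW (chi_gt0 u)) (HK u) => Xu Xu0 HKu.
apply: (@le_trans _ _ (Xu * (1 + `|u|) * `|v| *
    ((1 + `|u|) * ((1 + `|y + z|) * ((1 + B) * (1 + `|u|)))))).
  apply: ler_wpM2l; first by rewrite !mulr_ge0 ?addr_ge0.
  by apply: ler_wpM2l => //; rewrite addr_ge0.
rewrite [leLHS](_ : _ = (Xu * (1 + `|u|) ^+ 3) * (1 + B) * ((1 + `|y + z|) * `|v|));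
  last by ring.
apply: ler_pM => //.
  by rewrite !mulr_ge0 ?exprn_ge0 ?addr_ge0.
by rewrite ler_wpM2r ?addr_ge0.
Qed.

End chi.

Definition omega (k : R -> R) (t : R) (x : R * R) : R :=
  (1 + `|x.1 + k x.2|)^-1 * (1 + `|x.2 - t|)^-1.

Lemma continuous_invD1norm : continuous (fun s : R => (1 + `|s|)^-1).
Proof.
move=> s; apply: cvgV; first by rewrite gt_eqF// ltr_wpDr.
by apply: cvgD; [exact: cvg_cst|exact: norm_continuous].
Qed.

Lemma measurable_omega k t : measurable_fun setT k ->
  measurable_fun (setT : set M2) (omega k t).
Proof.
move=> mk; have mq := continuous_measurable_fun continuous_invD1norm.
apply: measurable_funM.
  apply: (measurableT_comp mq); apply: measurable_funD; first exact: measurable_fst.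
  by apply: (measurableT_comp mk); exact: measurable_snd.
apply: (measurableT_comp mq); apply: measurable_funB; first exact: measurable_snd.
exact: measurable_cst.
Qed.

Lemma integral_oneDsqrV : (\int[mu]_x (oneDsqr x)^-1%:E = pi%:E)%E.
Proof.
rewrite ge0_symfun_integralT.
- have -> : [set x : R | 0 <= x] = `[0, +oo[%classic.
    by apply/seteqP; split => x /=; rewrite in_itv/= andbT.
  by rewrite integral0y_oneDsqr -EFinM; congr EFin; field.
- by move=> x; rewrite invr_ge0.
- exact: continuous_oneDsqrV.
- by move=> x; rewrite /= /oneDsqr sqrrN.
Qed.

(** Since [(1 + |s|)^2 >= 1 + s^2], the square of each factor is at most a translate of
    [1 / (1 + s^2)], whose integral is [pi]. Every factor [pi] in the later constants comes from
    here. *)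
Lemma integral_omega k t : measurable_fun setT k ->
  (\int[leb2 R]_x (omega k t x ^+ 2)%:E <= (pi ^+ 2)%:E)%E.
Proof.
move=> mk; pose q (s : R) := (oneDsqr s)^-1.
have mq : measurable_fun setT q by exact: continuous_measurable_fun continuous_oneDsqrV.
have q0 s : 0 <= q s by rewrite invr_ge0.
have mqt : measurable_fun setT (fun s : R => q (s - t)).
  by apply: (measurableT_comp mq); apply: measurable_funB.
have qE (s : R) : (1 + `|s|)^-1 ^+ 2 <= q s.
  rewrite exprVn lef_pV2 ?posrE ?exprn_gt0 ?ltr_wpDr ?sqr_ge0//.
  by rewrite /oneDsqr -(real_normK (num_real s)); have := normr_ge0 s; nra.
have intqt : (\int[mu]_s (q (s - t))%:E = pi%:E)%E.
  rewrite -integral_oneDsqrV.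
  apply: (@ge0_integral_shift R (EFin \o q) (- t)) => [|r].
    exact/measurable_EFinP.
  by rewrite lee_fin.
have le1 : (\int[leb2 R]_x (omega k t x ^+ 2)%:E <=
    \int[leb2 R]_x (q (x.1 + k x.2) * q (x.2 - t))%:E)%E.
  apply: ge0_le_integral => //.
  - by move=> x _; rewrite lee_fin sqr_ge0.
  - by apply/measurable_EFinP/measurable_funX; exact: measurable_omega.
  - apply/measurable_EFinP; apply: measurable_funM.
      apply: (measurableT_comp mq); apply: measurable_funD; first exact: measurable_fst.
      by apply: (measurableT_comp mk); exact: measurable_snd.
    by apply: (measurableT_comp mqt); exact: measurable_snd.
  - move=> x _; rewrite lee_fin /omega exprMn.
    by rewrite ler_pM// ?sqr_ge0//; apply: qE.
apply: (le_trans le1).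
rewrite (@integral_shear R q (fun s => q (s - t)))// integral_oneDsqrV intqt.
by rewrite -EFinM expr2.
Qed.

Lemma L2norm_omega (f : field2 R) (K : R) k t : mspinor f ->
  measurable_fun setT k -> 0 <= K ->
  (forall x, spinor_norm (f x) <= K * omega k t x) ->
  (L2norm f <= (K * pi)%:E)%E.
Proof.
move=> mf mk K0 fK.
apply: (L2norm_le mf (g := fun x => K * omega k t x)) => //.
- by rewrite mulr_ge0 ?pi_ge0.
- by apply: measurable_funM; [exact: measurable_cst|exact: measurable_omega].
under eq_integral do rewrite exprMn EFinM.
rewrite ge0_integralZl//.
- rewrite exprMn [leRHS]EFinM; apply: lee_wpmul2l; first by rewrite lee_fin sqr_ge0.
  exact: integral_omega.
- by apply/measurable_EFinP/measurable_funX; exact: measurable_omega.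
- by move=> x _; rewrite lee_fin sqr_ge0.
- by rewrite lee_fin sqr_ge0.
Qed.

Lemma schwartz_der (p : R -> R) n x : schwartz_real p ->
  der x (derive1n n p) (derive1n n.+1 p x).
Proof.
by move=> [dp _]; rewrite derive1nS derive1E; exact/derivableP/dp.
Qed.

Lemma schwartz_decay (p : R -> R) n : schwartz_real p ->
  exists2 C, 0 <= C & forall s, (1 + `|s|) * `|derive1n n p s| <= C.
Proof.
move=> [_ bp]; have [M0 H0] := bp 0%N n; have [M1 H1] := bp 1%N n.
exists (`|M0| + `|M1|); first by rewrite addr_ge0.
move=> s; rewrite mulrDl mul1r; apply: lerD.
  by apply: le_trans (ler_norm _); have := H0 s; rewrite expr0 mul1r.
by apply: le_trans (ler_norm _); have := H1 s; rewrite expr1.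
Qed.

(** The weight [1 + |s|] puts the Taylor remainder in the form that [weight_bound] accepts, so that
    the remainder in time keeps the decay in space. *)
Lemma schwartz_taylor (p : R -> R) : schwartz_real p ->
  exists2 C, 0 <= C & forall d s, `|d| <= 1 ->
    (1 + `|s|) * `|p (s - d) - p s + d * derive1 p s| <= C * d ^+ 2.
Proof.
move=> sp; have [C C0 HC] := schwartz_decay 2 sp.
exists (2 * C) => [|d s d1]; first by rewrite mulr_ge0.
have d0 x := schwartz_der 0 x sp.
have d1' x := schwartz_der 1 x sp.
(* For [|r - s| <= 1] one has [1 + |s| <= 2 * (1 + |r|)], so [K] bounds the second derivative at
   every such [r]. *)
pose K := 2 * C / (1 + `|s|).
have s1 : 0 < 1 + `|s| by rewrite ltr_wpDr.
have K0 : 0 <= K by rewrite divr_ge0 ?mulr_ge0// ltW.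
have p2 r : `|r - s| <= `|d| -> `|derive1n 2 p r| <= K.
  move=> rs; rewrite /K ler_pdivlMr//.
  have := HC r; have := normr_ge0 (derive1n 2 p r).
  have : `|s| <= `|r| + 1.
    by have := ler_normB r (r - s); rewrite subKr; lra.
  have := normr_ge0 r; nra.
have p1 r : `|r - s| <= `|d| -> `|derive1n 1 p r - derive1n 1 p s| <= K * `|d|.
  move=> rs; apply: (@le_trans _ _ (K * `|r - s|)); last by rewrite ler_wpM2l.
  apply: (@der_lip R _ (derive1n 2 p)) => v rvs; split; first exact: d1'.
  apply: p2; apply: le_trans rs.
  move: rvs; have [rs|sr] := leP r s => /andP[? ?].
    by rewrite !ler0_norm; lra.
  by rewrite !ger0_norm; lra.
(* The remainder is [q d - q 0], and [- q'] is an increment of the first derivative of [p]; a second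
   use of the mean value theorem gives the quadratic bound. *)
pose q e := p (s - e) + e * derive1n 1 p s.
have : `|q d - q 0| <= K * `|d| * `|d - 0|.
  apply: (@der_lip R q (fun e => derive1n 1 p (s - e) * (0 - 1) +
     (1 * derive1n 1 p s + e * 0))) => e ed.
  split.
    have dsB : der e (fun e => s - e) (0 - 1).
      exact: is_deriveB (der_cst s e) (der_id e).
    have := derD (@der_comp R p (fun e => s - e) e _ _ (d0 (s - e)) dsB)
      (derM (der_id e) (der_cst (derive1n 1 p s) e)).
    exact.
  rewrite [X in `|X|](_ : _ = - (derive1n 1 p (s - e) - derive1n 1 p s)); last by ring.
  rewrite normrN; apply: p1; rewrite addrC addKr normrN.
  move: ed; have [d00|d00] := leP d 0 => /andP[? ?].
    by rewrite !ler0_norm; lra.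
  by rewrite !ger0_norm; lra.
rewrite /q !subr0 mul0r addr0 -mulrA -expr2 real_normK ?num_real//.
rewrite addrAC => qd.
apply: (@le_trans _ _ ((1 + `|s|) * (K * d ^+ 2))).
  by rewrite ler_wpM2l// ltW.
rewrite /K [leLHS](_ : _ = 2 * C * d ^+ 2)//; field; rewrite gt_eqF//.
Qed.

End edge_profile.

(** * Wave packets along the edge *)

Section wave_packets.
Context {R : realType}.
Local Notation M2 := (measurableTypeR R * measurableTypeR R)%type.
Local Notation der x f d := (is_derive (x : R) (1 : R) (f : R -> R) (d : R)).

Lemma der_eq (f : R -> R) x a b : der x f a -> a = b -> der x f b.
Proof. by move=> fa <-. Qed.

Lemma der_le_lip (f f' : R -> R) K : (forall x, der x f (f' x)) ->
  (forall x, `|f' x| <= K) -> forall a b, `|f a - f b| <= K * `|a - b|.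
Proof. by move=> df bf a b; apply: (der_lip (f' := f')) => s _; split. Qed.

Lemma der_continuous (f f' : R -> R) : (forall x, der x f (f' x)) -> continuous f.
Proof.
move=> df x; apply: differentiable_continuous; apply/derivable1_diffP.
by have [] := df x.
Qed.

Variables (m : R -> R) (C0 : R) (h : R -> R).
Hypotheses (wm : domain_wall m) (C0_gt0 : 0 < C0) (hC2 : class_C2 h).
Variables (B1 B2 : R).
Hypotheses (hB1 : forall x, `|derive1 h x| <= B1)
  (hB2 : forall x, `|derive1n 2 h x| <= B2).
Local Notation X := (chi m C0).

Let B10 : 0 <= B1. Proof. exact: le_trans (normr_ge0 _) (hB1 0). Qed.
Let B20 : 0 <= B2. Proof. exact: le_trans (normr_ge0 _) (hB2 0). Qed.

Let dh x : der x h (derive1 h x).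
Proof. by case: hC2 => d _ _; rewrite derive1E; exact/derivableP/d. Qed.

Let dh' x : der x (derive1 h) (derive1n 2 h x).
Proof. by case: hC2 => _ d _; rewrite [derive1n 2 h x]derive1E; exact/derivableP/d. Qed.

Let hlip := der_le_lip dh hB1.
Let h'lip := der_le_lip dh' hB2.

(** The powers of [eps] are kept inside the derivatives of [y |-> h (eps * y)], so the order of a
    term is read off by counting [edge_d1] once and [edge_d2] twice. *)
Definition edge (eps y : R) := h (eps * y).
Definition edge_d1 (eps y : R) := eps * derive1 h (eps * y).
Definition edge_d2 (eps y : R) := eps ^+ 2 * derive1n 2 h (eps * y).
Definition edge_dist (eps : R) (x : R * R) := x.1 + edge eps x.2.
(** The argument of [g] in the ansatz, regrouped as [y + z] with [y = x.2 - t], the centre to which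
    [chi_weight] transfers the decay. *)
Definition phase (eps t : R) (x : R * R) :=
  x.2 - t + - edge_d1 eps x.2 * edge_dist eps x.

Let dscale eps y : der y (fun s => eps * s) eps.
Proof. by apply: der_eq (derM (der_cst eps y) (der_id y)) _; ring. Qed.

Lemma der_edge eps y : der y (edge eps) (edge_d1 eps y).
Proof.
apply: der_eq (@der_comp R h (fun s => eps * s) y _ _ (dh _) (dscale eps y)) _.
by rewrite /edge_d1 mulrC.
Qed.

Lemma der_edge_d1 eps y : der y (edge_d1 eps) (edge_d2 eps y).
Proof.
apply: der_eq (derM (der_cst eps y)
  (@der_comp R (derive1 h) (fun s => eps * s) y _ _ (dh' _) (dscale eps y))) _.
by rewrite /edge_d2; ring.
Qed.

Lemma edge_d1_le eps y : 0 <= eps -> `|edge_d1 eps y| <= eps * B1.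
Proof. by move=> e0; rewrite /edge_d1 normrM ger0_norm// ler_wpM2l. Qed.

Lemma edge_d2_le eps y : `|edge_d2 eps y| <= eps ^+ 2 * B2.
Proof. by rewrite /edge_d2 normrM ger0_norm ?sqr_ge0// ler_wpM2l ?sqr_ge0. Qed.

Let mscale eps : measurable_fun setT (fun s : R => eps * s).
Proof. exact: measurable_funM. Qed.

Lemma measurable_edge eps : measurable_fun setT (edge eps).
Proof. exact: continuous_measurable_fun (der_continuous (der_edge eps)). Qed.

Lemma measurable_edge_d1 eps : measurable_fun setT (edge_d1 eps).
Proof. exact: continuous_measurable_fun (der_continuous (der_edge_d1 eps)). Qed.

Lemma measurable_edge_d2 eps : measurable_fun setT (edge_d2 eps).
Proof.
apply: measurable_funM => //.
apply: (measurableT_comp _ (mscale eps)).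
by case: hC2 => _ _; exact: continuous_measurable_fun.
Qed.

Lemma measurable_edge_dist eps : measurable_fun (setT : set M2) (edge_dist eps).
Proof.
apply: measurable_funD; first exact: measurable_fst.
by apply: (measurableT_comp (measurable_edge eps)); exact: measurable_snd.
Qed.

Lemma measurable_phase eps t : measurable_fun (setT : set M2) (phase eps t).
Proof.
apply: measurable_funD.
  by apply: measurable_funB; [exact: measurable_snd|exact: measurable_cst].
apply: measurable_funM; last exact: measurable_edge_dist.
apply: measurableT_comp => //.
by apply: (measurableT_comp (measurable_edge_d1 eps)); exact: measurable_snd.
Qed.

Lemma measurable_chi : measurable_fun setT X.
Proof.
have [K XK] := chi_lip wm C0_gt0.
apply: continuous_measurable_fun => x; apply/cvgrPdist_le => e e0.
have K1 : 0 < `|K| + 1 by rewrite ltr_wpDl.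
apply/nbhs_ballP; exists (e / (`|K| + 1)); first by rewrite /= divr_gt0.
move=> y; rewrite /ball/= => /ltW; rewrite ler_pdivlMr// => xy.
apply: (le_trans (XK _ _)); apply: le_trans xy; rewrite mulrC ler_wpM2l//.
by rewrite (le_trans (ler_norm K))// lerDl.
Qed.

Lemma measurable_weighted eps t (p : R -> R) : measurable_fun setT p ->
  measurable_fun (setT : set M2) (fun x => X (edge_dist eps x) * p (phase eps t x)).
Proof.
move=> mp; apply: measurable_funM.
  exact: (measurableT_comp measurable_chi (measurable_edge_dist eps)).
exact: (measurableT_comp mp (measurable_phase eps t)).
Qed.

(* Every real or imaginary part of the ansatz has this form, with [(b0, b1)]
   one of [(1, 0)], [(0, 1/2)] and [(0, -1/2)]. With [p'] the derivative of
   [p], the functions [packet1] and [packet2] below are its partial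
   derivatives wherever [m] is continuous at the distance to the edge. *)
Definition packet (eps t b0 b1 : R) (p : R -> R) (x : R * R) :=
  (b0 + b1 * edge_d1 eps x.2) * (X (edge_dist eps x) * p (phase eps t x)).

Definition packet1 (eps t b0 b1 : R) (p p' : R -> R) (x : R * R) :=
  (b0 + b1 * edge_d1 eps x.2) *
  (- m (edge_dist eps x) * (X (edge_dist eps x) * p (phase eps t x))
   - edge_d1 eps x.2 * (X (edge_dist eps x) * p' (phase eps t x))).

Definition packet2 (eps t b0 b1 : R) (p p' : R -> R) (x : R * R) :=
  b1 * edge_d2 eps x.2 * (X (edge_dist eps x) * p (phase eps t x)) +
  (b0 + b1 * edge_d1 eps x.2) *
  (- m (edge_dist eps x) * edge_d1 eps x.2 * (X (edge_dist eps x) * p (phase eps t x))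
   + (1 - edge_d1 eps x.2 ^+ 2) * (X (edge_dist eps x) * p' (phase eps t x))
   - edge_d2 eps x.2 * (edge_dist eps x * (X (edge_dist eps x) * p' (phase eps t x)))).

Section pointwise.
Variables (eps t : R) (p p' : R -> R).
Hypotheses (dp : forall x, der x p (p' x)).

Lemma der_packet1 b0 b1 x : {for edge_dist eps x, continuous m} ->
  der x.1 (fun s => packet eps t b0 b1 p (s, x.2)) (packet1 eps t b0 b1 p p' x).
Proof.
case: x => x y cm; rewrite /packet /packet1/=.
have du : der x (fun s => edge_dist eps (s, y)) 1.
  by apply: der_eq (derD (der_id x) (der_cst (edge eps y) x)) _; rewrite addr0.
have dxi : der x (fun s => phase eps t (s, y)) (- edge_d1 eps y).
  apply: der_eq (derD (der_cst (y - t) x) (derM (der_cst (- edge_d1 eps y) x) du)) _.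
  by ring.
have dX := @der_comp R X (fun s => edge_dist eps (s, y)) x _ _ (chi_der C0 wm cm) du.
have dP := @der_comp R p (fun s => phase eps t (s, y)) x _ _ (dp _) dxi.
apply: der_eq (derM (der_cst (b0 + b1 * edge_d1 eps y) x) (derM dX dP)) _.
by ring.
Qed.

Lemma der_packet2 b0 b1 x : {for edge_dist eps x, continuous m} ->
  der x.2 (fun s => packet eps t b0 b1 p (x.1, s)) (packet2 eps t b0 b1 p p' x).
Proof.
case: x => x y cm; rewrite /packet /packet2/=.
have du : der y (fun s => edge_dist eps (x, s)) (edge_d1 eps y).
  by apply: der_eq (derD (der_cst x y) (der_edge eps y)) _; rewrite add0r.
have de1N : der y (fun s => - edge_d1 eps s) (- edge_d2 eps y).
  exact: is_deriveN (der_edge_d1 eps y).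
have dxi : der y (fun s => phase eps t (x, s))
    (1 - edge_d1 eps y ^+ 2 - edge_d2 eps y * edge_dist eps (x, y)).
  by apply: der_eq (derD (derD (der_id y) (der_cst (- t) y)) (derM de1N du)) _; ring.
have dX := @der_comp R X (fun s => edge_dist eps (x, s)) y _ _ (chi_der C0 wm cm) du.
have dP := @der_comp R p (fun s => phase eps t (x, s)) y _ _ (dp _) dxi.
have db := derD (der_cst b0 y) (derM (der_cst b1 y) (der_edge_d1 eps y)).
apply: der_eq (derM db (derM dX dP)) _.
by ring.
Qed.

Lemma measurable_packet b0 b1 : measurable_fun setT p ->
  measurable_fun (setT : set M2) (packet eps t b0 b1 p).
Proof.
move=> mp; apply: measurable_funM; last exact: measurable_weighted.
apply: measurable_funD => //; apply: measurable_funM => //.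
by apply: (measurableT_comp (measurable_edge_d1 eps)); exact: measurable_snd.
Qed.

End pointwise.

Let mE1 eps : measurable_fun (setT : set M2) (fun x => edge_d1 eps x.2).
Proof. by apply: (measurableT_comp (measurable_edge_d1 eps)); exact: measurable_snd. Qed.

Let mE2 eps : measurable_fun (setT : set M2) (fun x => edge_d2 eps x.2).
Proof. by apply: (measurableT_comp (measurable_edge_d2 eps)); exact: measurable_snd. Qed.

Let mmN eps : measurable_fun (setT : set M2) (fun x => - m (edge_dist eps x)).
Proof.
apply: measurableT_comp => //.
exact: (measurableT_comp (wall_measurable wm) (measurable_edge_dist eps)).
Qed.

Let mB eps b0 b1 : measurable_fun (setT : set M2) (fun x => b0 + b1 * edge_d1 eps x.2).
Proof. by apply: measurable_funD => //; apply: measurable_funM. Qed.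

Lemma measurable_packet1 eps t b0 b1 p p' :
  measurable_fun setT p -> measurable_fun setT p' ->
  measurable_fun (setT : set M2) (packet1 eps t b0 b1 p p').
Proof.
move=> mp mp'; apply: measurable_funM => //.
apply: measurable_funB; apply: measurable_funM => //; exact: measurable_weighted.
Qed.

Lemma measurable_packet2 eps t b0 b1 p p' :
  measurable_fun setT p -> measurable_fun setT p' ->
  measurable_fun (setT : set M2) (packet2 eps t b0 b1 p p').
Proof.
move=> mp mp'; apply: measurable_funD.
  apply: measurable_funM; last exact: measurable_weighted.
  by apply: measurable_funM.
apply: measurable_funM => //; apply: measurable_funB; last first.
  apply: measurable_funM => //; apply: measurable_funM; first exact: measurable_edge_dist.
  exact: measurable_weighted.
apply: measurable_funD; apply: measurable_funM; try exact: measurable_weighted.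
- by apply: measurable_funM.
- by apply: measurable_funB => //; exact: measurable_funX.
Qed.

(** Only on boxes: the phase contains the product of [edge_d1] and the unbounded [edge_dist], which
    need not be globally Lipschitz. *)
Lemma lipbox_packet eps t b0 b1 p p' K N :
  (forall x, der x p (p' x)) -> (forall x, `|p' x| <= K) ->
  lipbox N (packet eps t b0 b1 p).
Proof.
move=> dp bp.
have [L XL] := chi_lip wm C0_gt0.
have ls : lipbox N (fun x : R * R => eps * x.2).
  by apply: lipboxM; [exact: lipbox_cst|exact: lipbox_snd].
have lu : lipbox N (edge_dist eps).
  by apply: lipboxD; [exact: lipbox_fst|exact: lipbox_comp hlip ls].
have l1 : lipbox N (fun x => edge_d1 eps x.2).
  by apply: lipboxM; [exact: lipbox_cst|exact: lipbox_comp h'lip ls].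
have lxi : lipbox N (phase eps t).
  apply: lipboxD; first by apply: lipboxD; [exact: lipbox_snd|exact: lipbox_cst].
  apply: lipboxM => //; apply: (@lipbox_comp R N 1 (fun y => - y)) => // a b.
  by rewrite mul1r -opprD normrN.
apply: lipboxM.
  by apply: lipboxD; [exact: lipbox_cst|apply: lipboxM => //; exact: lipbox_cst].
by apply: lipboxM; [exact: lipbox_comp XL lu|exact: lipbox_comp (der_le_lip dp bp) lxi].
Qed.

(** Here [K] may depend on [eps] and [t]: the notion serves membership in [L^2] and local
    boundedness, while uniform estimates go through [weight_bound]. *)
Definition dominated eps t (F : R * R -> R) := exists2 K, 0 <= K &
  forall x, `|F x| <= K * omega (edge eps) t x.

Lemma omega_ge0 k t (x : R * R) : 0 <= omega k t x.
Proof. by rewrite mulr_ge0 ?invr_ge0 ?addr_ge0. Qed.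

Lemma omega_le1 k t (x : R * R) : omega k t x <= 1.
Proof.
have H (s : R) : 0 <= (1 + `|s|)^-1 <= 1.
  by rewrite invr_ge0 addr_ge0//= invf_le1 ?ltr_wpDr// lerDl.
by rewrite mulr_ile1; have /andP[] := H (x.1 + k x.2); have /andP[] := H (x.2 - t).
Qed.

Lemma dominatedD eps t F G : dominated eps t F -> dominated eps t G ->
  dominated eps t (fun x => F x + G x).
Proof.
move=> [K K0 FK] [L L0 GL]; exists (K + L) => [|x]; first exact: addr_ge0.
by rewrite mulrDl (le_trans (ler_normD _ _))// lerD.
Qed.

Lemma dominatedN eps t F : dominated eps t F -> dominated eps t (fun x => - F x).
Proof. by move=> [K K0 FK]; exists K => // x; rewrite normrN. Qed.

Lemma dominatedM eps t (c : R) F G : (forall x, `|G x| <= c) -> dominated eps t F ->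
  dominated eps t (fun x => G x * F x).
Proof.
move=> Gc [K K0 FK]; have c0 : 0 <= c := le_trans (normr_ge0 _) (Gc 0).
exists (c * K) => [|x]; first exact: mulr_ge0.
by rewrite normrM -mulrA ler_pM.
Qed.

(* [K] depends neither on [eps] nor on [t]; this is what makes the final
   constant uniform. *)
Lemma weight_bound : exists2 K : R, 0 <= K & forall eps t Cv (p : R -> R),
  0 <= eps <= 1 -> (forall s, (1 + `|s|) * `|p s| <= Cv) ->
  forall x, (1 + `|edge_dist eps x|) * `|X (edge_dist eps x) * p (phase eps t x)| <=
    K * Cv * omega (edge eps) t x.
Proof.
have [K K0 HK] := chi_weight wm C0_gt0 B10.
exists K => // eps t Cv p /andP[eps0 eps1] pC x.
have := HK (edge_dist eps x) (x.2 - t) (- edge_d1 eps x.2 * edge_dist eps x)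
  (p (phase eps t x)) Cv.
have le1 : `|- edge_d1 eps x.2 * edge_dist eps x| <= B1 * `|edge_dist eps x|.
  rewrite normrM normrN ler_wpM2r// (le_trans (edge_d1_le _ eps0))//.
  by rewrite ler_piMl.
move=> /(_ le1 (pC _)); rewrite normrM gtr0_norm ?chi_gt0//.
rewrite /omega -/(edge_dist eps x) invfM; apply: le_trans.
by rewrite mulrA [_ * X _]mulrC.
Qed.

Section packet_estimates.
Variables (eps t : R) (p p' : R -> R) (Cp Cp' : R).
Hypotheses (eps01 : 0 <= eps <= 1) (dp : forall x, der x p (p' x)).
Hypotheses (pC : forall s, (1 + `|s|) * `|p s| <= Cp)
  (p'C : forall s, (1 + `|s|) * `|p' s| <= Cp').

Lemma dominated_weighted (q : R -> R) C : (forall s, (1 + `|s|) * `|q s| <= C) ->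
  dominated eps t (fun x => X (edge_dist eps x) * q (phase eps t x)).
Proof.
move=> qC; have [K K0 HK] := weight_bound.
have C00 : 0 <= C by apply: le_trans (qC 0); rewrite mulr_ge0 ?addr_ge0.
exists (K * C) => [|x]; first exact: mulr_ge0.
by apply: le_trans (HK _ t _ _ eps01 qC x); rewrite ler_peMl// lerDl.
Qed.

Lemma dominated_uweighted (q : R -> R) C : (forall s, (1 + `|s|) * `|q s| <= C) ->
  dominated eps t (fun x => edge_dist eps x * (X (edge_dist eps x) * q (phase eps t x))).
Proof.
move=> qC; have [K K0 HK] := weight_bound.
have C00 : 0 <= C by apply: le_trans (qC 0); rewrite mulr_ge0 ?addr_ge0.
exists (K * C) => [|x]; first exact: mulr_ge0.
by apply: le_trans (HK _ t _ _ eps01 qC x); rewrite normrM ler_wpM2r// lerDr.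
Qed.

Let eps0 : 0 <= eps. Proof. by case/andP: eps01. Qed.

Let bB b0 b1 (x : R * R) : `|b0 + b1 * edge_d1 eps x.2| <= `|b0| + `|b1| * (eps * B1).
Proof.
rewrite (le_trans (ler_normD _ _))// lerD// normrM ler_wpM2l//.
exact: edge_d1_le.
Qed.

Lemma dominated_packet b0 b1 : dominated eps t (packet eps t b0 b1 p).
Proof. exact: dominatedM (bB b0 b1) (dominated_weighted pC). Qed.

Lemma dominated_packet1 b0 b1 : dominated eps t (packet1 eps t b0 b1 p p').
Proof.
have [M M0 mM] := domain_wall_bounded wm.
apply: dominatedM (bB b0 b1) _; apply: dominatedD.
  by apply: dominatedM (dominated_weighted pC) => x; rewrite normrN; exact: mM.
apply: dominatedN; apply: dominatedM (dominated_weighted p'C) => x; exact: edge_d1_le.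
Qed.

Lemma dominated_packet2 b0 b1 : dominated eps t (packet2 eps t b0 b1 p p').
Proof.
have [M M0 mM] := domain_wall_bounded wm.
apply: dominatedD.
  apply: (@dominatedM _ _ (`|b1| * (eps ^+ 2 * B2))) (dominated_weighted pC) => x.
  by rewrite normrM ler_wpM2l// edge_d2_le.
apply: dominatedM (bB b0 b1) _; apply: dominatedD; first apply: dominatedD.
- apply: (@dominatedM _ _ (M * (eps * B1))) (dominated_weighted pC) => x.
  rewrite normrM normrN; apply: ler_pM => //; exact: edge_d1_le.
- apply: (@dominatedM _ _ (1 + (eps * B1) ^+ 2)) (dominated_weighted p'C) => x.
  rewrite (le_trans (ler_normB _ _))// normr1 lerD2l normrX.
  by apply: lerXn2r; rewrite ?nnegrE ?mulr_ge0//; exact: edge_d1_le.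
- by apply: dominatedN; apply: dominatedM (dominated_uweighted p'C) => x; exact: edge_d2_le.
Qed.

Lemma dominated_bounded F : dominated eps t F -> forall N, exists K : R,
  forall x, box N x -> `|F x| <= K.
Proof.
move=> [K K0 FK] N; exists K => x _; apply: (le_trans (FK x)).
by rewrite ler_piMr// omega_le1.
Qed.

Hypotheses (mp : measurable_fun setT p) (mp' : measurable_fun setT p').

Let p'_le s : `|p' s| <= Cp'.
Proof. by apply: le_trans (p'C s); rewrite ler_peMl// lerDl. Qed.

Let ae_cont : {ae leb2 R, forall x : R * R, {for edge_dist eps x, continuous m}}.
Proof.
have aeF := ae_filter_ringOfSetsType (leb2 R).
have := ae_shear_notin (domain_wall_discontinuities wm) (measurable_edge eps).
by apply: filterS => x /contrapT.
Qed.

Lemma weak_derivative1_packet b0 b1 : weak_derivative (@partial1 R)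
  (packet eps t b0 b1 p) (packet1 eps t b0 b1 p p').
Proof.
have aeF := ae_filter_ringOfSetsType (leb2 R).
apply: weak_derivative1.
- exact: measurable_packet.
- exact: measurable_packet1.
- by move=> N; exact: lipbox_packet dp p'_le.
- exact/dominated_bounded/dominated_packet1.
- by move: ae_cont; apply: filterS => x; exact: der_packet1.
Qed.

Lemma weak_derivative2_packet b0 b1 : weak_derivative (@partial2 R)
  (packet eps t b0 b1 p) (packet2 eps t b0 b1 p p').
Proof.
have aeF := ae_filter_ringOfSetsType (leb2 R).
apply: weak_derivative2.
- exact: measurable_packet.
- exact: measurable_packet2.
- by move=> N; exact: lipbox_packet dp p'_le.
- exact/dominated_bounded/dominated_packet2.
- by move: ae_cont; apply: filterS => x; exact: der_packet2.
Qed.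

End packet_estimates.
End wave_packets.

(** * Spinors in real coordinates, and a growth lemma on the half-line *)

Section spinor_fields.
Context {R : realType}.
Local Notation M2 := (measurableTypeR R * measurableTypeR R)%type.

Definition spin (a b c d : R) : spinor R := mk_spinor (a +i* b)%C (c +i* d)%C.

Lemma ord2P (j : 'I_2) : (j = 0) \/ (j = 1).
Proof. by case: j => [[|[|]]] // ?; [left|right]; exact/val_inj. Qed.

Lemma spin0 a b c d : spin a b c d 0 0 = (a +i* b)%C.
Proof. by rewrite /spin /mk_spinor mxE. Qed.

Lemma spin1 a b c d : spin a b c d 1 0 = (c +i* d)%C.
Proof. by rewrite /spin /mk_spinor mxE. Qed.

Lemma spinP (v w : spinor R) : v 0 0 = w 0 0 -> v 1 0 = w 1 0 -> v = w.
Proof. by move=> H0 H1; apply/matrixP => j k; rewrite ord1; have [->|->] := ord2P j. Qed.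

Lemma spinD a b c d a' b' c' d' : spin a b c d + spin a' b' c' d' =
  spin (a + a') (b + b') (c + c') (d + d').
Proof. by apply: spinP; rewrite mxE !(spin0, spin1). Qed.

Lemma spinN a b c d : - spin a b c d = spin (- a) (- b) (- c) (- d).
Proof. by apply: spinP; rewrite mxE !(spin0, spin1). Qed.

Lemma complex_eq (z z' : R[i]) : complex.Re z = complex.Re z' ->
  complex.Im z = complex.Im z' -> z = z'.
Proof. by case: z => ? ?; case: z' => ? ? /= -> ->. Qed.

Lemma Re_imag : complex.Re ('i : R[i]) = 0. Proof. by rewrite -complexiE. Qed.
Lemma Im_imag : complex.Im ('i : R[i]) = 1. Proof. by rewrite -complexiE. Qed.

Lemma spinZ (k : R) a b c d : k%:C%C *: spin a b c d =
  spin (k * a) (k * b) (k * c) (k * d).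
Proof.
by apply: spinP; rewrite mxE !(spin0, spin1); apply: complex_eq;
  rewrite ?ReZ ?ImZ/=; ring.
Qed.

Lemma spin_i a b c d : ('i : R[i]) *: spin a b c d = spin (- b) a (- d) c.
Proof.
by apply: spinP; rewrite mxE !(spin0, spin1); apply: complex_eq;
  rewrite ?ReZ ?ImZ Re_imag Im_imag/=; ring.
Qed.

Definition spinf (A B C D : R * R -> R) : field2 R :=
  fun x => spin (A x) (B x) (C x) (D x).

Lemma spinf_reals A B C D j :
  (fun x => complex.Re (spinf A B C D x j 0)) = (if j == 0 then A else C) /\
  (fun x => complex.Im (spinf A B C D x j 0)) = (if j == 0 then B else D).
Proof.
by have [->|->] := ord2P j; split; apply/funext => x; rewrite /spinf ?spin0 ?spin1.
Qed.

Lemma mspinor_spinf A B C D :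
  measurable_fun (setT : set M2) A -> measurable_fun (setT : set M2) B ->
  measurable_fun (setT : set M2) C -> measurable_fun (setT : set M2) D ->
  mspinor (spinf A B C D).
Proof.
by move=> mA mB mC mD; split => j; have [Er Ei] := spinf_reals A B C D j;
  rewrite ?Er ?Ei; case: ifP.
Qed.

Lemma spinf_weak pd A B C D A' B' C' D' :
  weak_derivative pd A A' -> weak_derivative pd B B' ->
  weak_derivative pd C C' -> weak_derivative pd D D' ->
  spinor_weak_derivative pd (spinf A B C D) (spinf A' B' C' D').
Proof.
move=> wA wB wC wD j; have [Er Ei] := spinf_reals A B C D j.
have [Er' Ei'] := spinf_reals A' B' C' D' j.
by rewrite Er Ei Er' Ei'; case: ifP.
Qed.

Lemma spin_norm_le a b c d k :
  `|a| <= k -> `|b| <= k -> `|c| <= k -> `|d| <= k ->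
  spinor_norm (spin a b c d) <= 2 * k.
Proof.
by move=> ak bk ck dk; apply: spinor_norm_le => j;
  have [->|->] := ord2P j; rewrite ?spin0 ?spin1.
Qed.

(* The radius [d] depends on the point, hence the supremum argument. *)
Lemma local_lipschitz_growth (phi : R -> R) (K : R) : phi 0 = 0 -> 0 <= K ->
  (forall t, exists2 d, 0 < d & forall e, `|e| < d ->
     `|phi (t + e) - phi t| <= K * `|e|) ->
  forall t, 0 <= t -> phi t <= K * t.
Proof.
move=> phi0 K0 lip t t0.
pose S := [set s | 0 <= s <= t /\ phi s <= K * s].
have S0 : S 0 by split; rewrite ?lexx ?t0 ?phi0 ?mulr0.
have supS : has_sup S.
  by split; [exists 0|exists t => s [/andP[]]].
have ct : sup S <= t by apply: ge_sup; [exists 0|move=> s [/andP[]]].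
have c0 : 0 <= sup S by apply: sup_upper_bound.
have [d d0 Hd] := lip (sup S).
(* The set contains its supremum: the local bound at [sup S] is read backwards, with an increment
   that is not positive. *)
have Sc : phi (sup S) <= K * sup S.
  have [s Ss sd] := sup_adherent d0 supS.
  have sc : s <= sup S by exact: sup_upper_bound.
  have := Hd (s - sup S); rewrite [sup S + _]addrC subrK ler0_norm ?subr_le0// => H.
  have /H : - (s - sup S) < d by lra.
  case: Ss => _ ?; rewrite ler_norml => /andP[? _]; nra.
have [tc|ct'] := leP t (sup S).
  by have -> : t = sup S by apply/eqP; rewrite eq_le tc ct.
pose e := Num.min (d / 2) (t - sup S).
have e0 : 0 < e by rewrite lt_min divr_gt0//= subr_gt0.
have ed : e < d by rewrite gt_min; apply/orP; left; lra.
have et : e <= t - sup S by rewrite ge_min lexx orbT.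
have := Hd e; rewrite gtr0_norm// => /(_ ed); rewrite ler_norml => /andP[_ He].
have : S (sup S + e) by split; [apply/andP; split; lra|nra].
by move=> /(sup_upper_bound supS); lra.
Qed.

End spinor_fields.

(** * The residual of the ansatz over a time increment *)

Section residual_bounds.
Context {R : realType}.

Lemma normM_le (a z ca cz : R) : `|a| <= ca -> `|z| <= cz -> `|a * z| <= ca * cz.
Proof. by move=> *; rewrite normrM ler_pM. Qed.

Lemma normD_le (a b ca cb : R) : `|a| <= ca -> `|b| <= cb -> `|a + b| <= ca + cb.
Proof. by move=> *; rewrite (le_trans (ler_normD _ _))// lerD. Qed.

Lemma normN_le (a ca : R) : `|a| <= ca -> `|- a| <= ca.
Proof. by rewrite normrN. Qed.

Variables (m : R -> R) (C0 : R) (h : R -> R).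
Hypotheses (wm : domain_wall m) (C0_gt0 : 0 < C0) (hC2 : class_C2 h).
Variables (B1 B2 : R).
Hypotheses (hB1 : forall x, `|derive1 h x| <= B1)
  (hB2 : forall x, `|derive1n 2 h x| <= B2).
Local Notation X := (chi m C0).
Variables (M K : R).
Hypothesis mM : forall u, `|m u| <= M.
(** The conclusion of [weight_bound] for one fixed [K], chosen ahead of [eps] and [t]. *)
Hypothesis weight : forall eps t Cv (p : R -> R),
  0 <= eps <= 1 -> (forall s, (1 + `|s|) * `|p s| <= Cv) ->
  forall x, (1 + `|edge_dist h eps x|) *
      `|X (edge_dist h eps x) * p (phase h eps t x)| <=
    K * Cv * omega (edge h eps) t x.

Lemma phaseD eps t d x : phase h eps (t + d) x = phase h eps t x - d.
Proof. by rewrite /phase; ring. Qed.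

Section residual.
Variables (p p' : R -> R) (C T : R).
Hypotheses (pC : forall s, (1 + `|s|) * `|p s| <= C)
  (p'C : forall s, (1 + `|s|) * `|p' s| <= C)
  (pT : forall d s, `|d| <= 1 ->
    (1 + `|s|) * `|p (s - d) - p s + d * p' s| <= T * d ^+ 2).
Variables (eps t d : R) (x : R * R).
Hypotheses (eps01 : 0 <= eps <= 1) (d1 : `|d| <= 1).
Local Notation om := (omega (edge h eps) t x).
Local Notation u := (edge_dist h eps x).
Local Notation Ex := (edge_d1 h eps x.2).
Local Notation Fx := (edge_d2 h eps x.2).
Local Notation V := (m (edge_dist h eps x)).

Let eps0 : 0 <= eps. Proof. by case/andP: eps01. Qed.
Let eps1 : eps <= 1. Proof. by case/andP: eps01. Qed.
Let E1 : `|Ex| <= eps * B1. Proof. exact: edge_d1_le. Qed.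
Let E2 : `|Fx| <= eps ^+ 2 * B2. Proof. exact: edge_d2_le. Qed.
Let E1' : `|Ex| <= B1.
Proof.
apply: (le_trans E1); rewrite ler_piMl//; exact: le_trans (normr_ge0 _) (hB1 0).
Qed.

Let w (q : R -> R) := X u * q (phase h eps t x).
(** Time enters only through the phase, which [t + d] lowers by [d]; so [r] is the whole Taylor
    remainder in time. *)
Let r (s : R) := p (s - d) - p s + d * p' s.

Let wle (q : R -> R) c : (forall s, (1 + `|s|) * `|q s| <= c) ->
  `|w q| <= K * c * om.
Proof.
by move=> qc; apply: le_trans (weight t eps01 qc x); rewrite ler_peMl// lerDl.
Qed.

Let uwle (q : R -> R) c : (forall s, (1 + `|s|) * `|q s| <= c) ->
  `|u * w q| <= K * c * om.
Proof.
by move=> qc; apply: le_trans (weight t eps01 qc x); rewrite normrM ler_wpM2r// lerDr.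
Qed.

(** The term in [V * Ex] from [packet2] cancels against two halves, one from [V * packet] and one
    from [packet1]. Besides the remainder in [r] there survive [Ex ^+ 2] and [Fx], both of order
    [eps ^+ 2]. *)
Lemma residual_fst :
  `|packet m C0 h eps t 1 0 p x - packet m C0 h eps (t + d) 1 0 p x
    - d * (packet2 m C0 h eps t 1 0 p p' x
       + (V * packet m C0 h eps t 0 (1 / 2) p x
          - packet1 m C0 h eps t 0 (1 / 2) p p' x))|
  <= (`|d| * eps ^+ 2 * ((B1 ^+ 2 / 2 + B2) * (K * C)) + d ^+ 2 * (K * T)) * om.
Proof.
rewrite (_ : _ - _ = - w r + d * (Ex * Ex / 2 * w p' + Fx * (u * w p'))); last first.
  by rewrite /packet /packet1 /packet2 phaseD /w /r; field.
have b1 : `|- w r| <= K * (T * d ^+ 2) * om.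
  by apply: normN_le; apply: wle => s; exact: pT.
have b2 : `|Ex * Ex / 2 * w p'| <= eps * B1 * (eps * B1) * 2^-1 * (K * C * om).
  apply: normM_le; last exact: wle.
  by apply: normM_le; [exact: normM_le|rewrite ger0_norm// invr_ge0].
have b3 : `|Fx * (u * w p')| <= eps ^+ 2 * B2 * (K * C * om).
  by apply: normM_le => //; exact: uwle.
apply: (le_trans (normD_le b1 (normM_le (lexx `|d|) (normD_le b2 b3)))).
rewrite [leLHS](_ : _ = (`|d| * eps ^+ 2 * ((B1 ^+ 2 / 2 + B2) * (K * C))
  + d ^+ 2 * (K * T)) * om)//; by field.
Qed.

(** The terms [Ex * w p'] occur with coefficients [1/2], [-1] and [1/2] and cancel. In the terms
    with more powers of [eps] than two, and in the Taylor remainder, [Ex] is bounded by [B1] alone,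
    using [eps <= 1]. *)
Lemma residual_snd :
  `|packet m C0 h eps t 0 (1 / 2) p x - packet m C0 h eps (t + d) 0 (1 / 2) p x
    + d * ((V * packet m C0 h eps t 1 0 p x + packet1 m C0 h eps t 1 0 p p' x)
           + packet2 m C0 h eps t 0 (1 / 2) p p' x)|
  <= (`|d| * eps ^+ 2 *
        ((B2 / 2 + B1 ^+ 2 * M / 2 + B1 * (B1 ^+ 2 + B2) / 2) * (K * C))
      + d ^+ 2 * (B1 / 2 * (K * T))) * om.
Proof.
rewrite (_ : _ + _ = - (Ex * 2^-1 * w r) +
  d * (Fx * 2^-1 * w p + - (Ex * Ex * V * 2^-1 * w p)
    + - (Ex * 2^-1 * (Ex * Ex * w p' + Fx * (u * w p'))))); last first.
  by rewrite /packet /packet1 /packet2 phaseD /w /r; field.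
have h2 : `|2^-1 : R| <= 2^-1 by rewrite ger0_norm// invr_ge0.
have b1 : `|- (Ex * 2^-1 * w r)| <= B1 * 2^-1 * (K * (T * d ^+ 2) * om).
  apply: normN_le; apply: normM_le; first exact: normM_le.
  by apply: wle => s; exact: pT.
have b2 : `|Fx * 2^-1 * w p| <= eps ^+ 2 * B2 * 2^-1 * (K * C * om).
  by apply: normM_le; [exact: normM_le|exact: wle].
have b3 : `|- (Ex * Ex * V * 2^-1 * w p)| <=
    eps * B1 * (eps * B1) * M * 2^-1 * (K * C * om).
  apply: normN_le; apply: normM_le; last exact: wle.
  by do 2![apply: normM_le => //]; exact: normM_le.
have b4 : `|- (Ex * 2^-1 * (Ex * Ex * w p' + Fx * (u * w p')))| <=
    B1 * 2^-1 * (eps * B1 * (eps * B1) * (K * C * om) + eps ^+ 2 * B2 * (K * C * om)).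
  apply: normN_le; apply: normM_le; first exact: normM_le.
  apply: normD_le; apply: normM_le; [exact: normM_le|exact: wle|by []|exact: uwle].
apply: (le_trans (normD_le b1 (normM_le (lexx `|d|) (normD_le (normD_le b2 b3) b4)))).
rewrite [leLHS](_ : _ = (`|d| * eps ^+ 2 *
  ((B2 / 2 + B1 ^+ 2 * M / 2 + B1 * (B1 ^+ 2 + B2) / 2) * (K * C))
      + d ^+ 2 * (B1 / 2 * (K * T))) * om)//; by field.
Qed.

End residual.
End residual_bounds.

(** * Stability of unitary evolutions *)

Section unitary_groups.
Context {R : realType}.
Implicit Types (f g : field2 R).

Lemma L2normN f : mspinor f -> L2norm (fun x => - f x) = L2norm f.
Proof.
move=> mf; have := L2normZ (-1) mf; rewrite normrN1 mul1e => <-.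
congr L2norm; apply/funext => x.
by rewrite (_ : (-1)%:C%C = -1 :> R[i]) ?scaleN1r// rmorphN1.
Qed.

Lemma L2normB f g : mspinor f -> mspinor g ->
  (L2norm (fun x => f x - g x)%R <= L2norm f + L2norm g)%E.
Proof.
move=> mf mg; rewrite -(L2normN mg); apply: L2normD => //.
have -> : (fun x => - g x) = (fun x => (-1) *: g x).
  by apply/funext => x; rewrite scaleN1r.
exact: mspinorZ.
Qed.

Lemma in_L2B f g : in_L2 f -> in_L2 g -> in_L2 (fun x => f x - g x).
Proof.
move=> Lf Lg; have [mf mg] := (in_L2_mspinor Lf, in_L2_mspinor Lg).
have [mr mi] := mspinorB mf mg; split => //.
apply: le_lt_trans (L2normB mf mg) _; case: Lf => _ _ Lf; case: Lg => _ _ Lg.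
exact: lte_add_pinfty.
Qed.

Lemma L2norm_fin f : in_L2 f -> L2norm f \is a fin_num.
Proof. by case=> _ _ Lf; rewrite ge0_fin_numE// L2norm_ge0. Qed.

Lemma exp_group_isometry (A : field2 R -> field2 R -> Prop) U t f g :
  exp_group A U -> in_L2 f -> in_L2 g ->
  L2norm (fun x => U t f x - U t g x) = L2norm (fun x => f x - g x).
Proof.
move=> gU Lf Lg; have aeF := ae_filter_ringOfSetsType (leb2 R).
have E : (fun x => f x - g x) = (fun x => (-1) *: g x + f x).
  by apply/funext => x; rewrite scaleN1r addrC.
rewrite -(exp_isometry gU t (in_L2B Lf Lg)).
apply: L2norm_ae.
- by apply: mspinorB; apply: in_L2_mspinor; exact: (exp_L2 gU).
- by apply: in_L2_mspinor; apply: (exp_L2 gU); exact: in_L2B.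
rewrite E; have := exp_linear gU t (-1) Lg Lf; apply: filterS => x /= /(_ I) ->.
by move=> _; rewrite scaleN1r addrC.
Qed.

(* [kap] is the rate at which [a] fails to solve the equation; the term in
   [d ^+ 2] is the Taylor remainder of [a] in time. *)
Lemma duhamel_bound (A : field2 R -> field2 R -> Prop) U (a : R -> field2 R)
    (f0 : field2 R) (kap c : R) :
  exp_group A U -> 0 <= kap -> 0 <= c -> in_L2 f0 -> f0 = a 0 %[ae leb2 R] ->
  (forall t, in_L2 (a t)) ->
  (forall t, exists w, [/\ in_L2 w, A (a t) w & forall d : R, `|d| <= 1 ->
    (L2norm (fun x => a t x - a (t + d)%R x + d%:C%C *: ('i *: w x))%R <=
      (`|d| * kap + d ^+ 2 * c)%:E)%E]) ->
  forall eta t, 0 < eta -> 0 <= t ->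
    (L2norm (fun x => U t f0 x - a t x)%R <= ((kap + eta) * t)%:E)%E.
Proof.
move=> gU kap0 c0 Lf0 f0a La step eta t eta0 t0.
have aeF := ae_filter_ringOfSetsType (leb2 R).
have Lb s : in_L2 (U s f0) by exact: (exp_L2 gU).
have Ldiff s : in_L2 (fun x => U s f0 x - a s x) by exact: in_L2B.
pose phi s := fine (L2norm (fun x => U s f0 x - a s x)).
have phiE s : L2norm (fun x => U s f0 x - a s x) = (phi s)%:E.
  by rewrite fineK// L2norm_fin.
rewrite phiE lee_fin; apply: (@local_lipschitz_growth R phi) => //.
- have -> : phi 0 = fine (L2norm (fun=> 0 : spinor R)); last first.
    rewrite L2normE (eq_integral (fun=> 0%E)).
      by rewrite integral0 poweR0r// invr_neq0.
    move=> x _; have := spinor_normZ 0 (0 : spinor R).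
    by rewrite normr0 mul0r scaler0 => ->; rewrite expr0n.
  congr fine; apply: L2norm_ae.
  + exact: in_L2_mspinor.
  + by split => j; under eq_fun do rewrite mxE /=; exact: measurable_cst.
  have := exp_0 gU Lf0; apply: filterS2 f0a => x /= f0ax U0x _.
  by rewrite U0x// f0ax// subrr.
- by rewrite addr_ge0// ltW.
move=> {t t0} t; have [w [Lw Aw wd]] := step t.
have := (exp_generator gU (La t) Lw).1 Aw.
move=> /fine_cvgP[/nbhs_ballP[r1 /= r10 fin1]].
move=> /cvgrPdist_lt/(_ (eta / 2)).
rewrite divr_gt0// => /(_ isT)/nbhs_ballP[r2 /= r20 lt2].
(* Half of [eta] pays for the generator limit, the other half for [e ^+ 2 * c], which is at most
   [|e| * (eta / 2)] once [|e| < r3]. The [1] covers the case [c = 0]. *)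
pose r3 := eta / (2 * (c + 1)).
have c1 : 0 < c + 1 by rewrite ltr_wpDl.
have r30 : 0 < r3 by rewrite divr_gt0// mulr_gt0.
exists (Num.min (Num.min r1 r2) (Num.min 1 r3)).
  by rewrite !lt_min r10 r20 r30 ltr01.
move=> e; rewrite !lt_min => /andP[/andP[e1 e2] /andP[e3 e4]].
have [->|en0] := eqVneq e 0; first by rewrite addr0 subrr normr0 mulr0.
(* [Y] is the error of the difference quotient of the group and [S] the residual of [a]; [e] times
   [Y] plus [S] is the difference between [U e (a t)] and [a (t + e)]. *)
pose Y x := (e^-1)%:C%C *: (U e (a t) x - a t x) - 'i *: w x.
pose S x := a t x - a (t + e) x + e%:C%C *: ('i *: w x).
have mUa : mspinor (U e (a t)) by apply: in_L2_mspinor; exact: (exp_L2 gU).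
have ma s : mspinor (a s) by exact: in_L2_mspinor.
have mw : mspinor (fun x => 'i *: w x) by apply: mspinorZ; exact: in_L2_mspinor.
have mY : mspinor Y by apply: mspinorB => //; apply: mspinorZ; exact: mspinorB.
have mS : mspinor S by apply: mspinorD; [exact: mspinorB|exact: mspinorZ].
have YE : (L2norm Y <= (eta / 2)%:E)%E.
  have b1 : ball (0 : R) r1 e by rewrite /ball/= sub0r normrN.
  have b2 : ball (0 : R) r2 e by rewrite /ball/= sub0r normrN.
  rewrite -(fineK (fin1 e b1 en0)) lee_fin ltW//.
  by have := lt2 e b2 en0; rewrite sub0r normrN; apply: le_lt_trans; exact: ler_norm.
have LE : in_L2 (fun x => U e (a t) x - a (t + e) x).
  by apply: in_L2B => //; exact: (exp_L2 gU).
pose err := fine (L2norm (fun x => U e (a t) x - a (t + e) x)).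
have errE : L2norm (fun x => U e (a t) x - a (t + e) x) = err%:E.
  by rewrite fineK// L2norm_fin.
have err_le : err <= (kap + eta) * `|e|.
  rewrite -lee_fin -errE.
  have -> : (fun x => U e (a t) x - a (t + e) x) = (fun x => e%:C%C *: Y x + S x).
    apply/funext => x; rewrite /Y /S scalerBr scalerA -rmorphM/= divff// scale1r.
    by rewrite addrACA addNr addr0 addrA subrK.
  apply: le_trans (L2normD (mspinorZ _ mY) mS) _.
  rewrite L2normZ//.
  apply: (@le_trans _ _ (`|e| * (eta / 2) + (`|e| * kap + e ^+ 2 * c))%:E).
    rewrite EFinD leeD//; last by apply: wd; exact: ltW.
    by rewrite EFinM lee_wpmul2l.
  rewrite lee_fin -(real_normK (num_real e)).
  move: e4; rewrite /r3 ltr_pdivlMr ?mulr_gt0// => e4.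
  have := normr_ge0 e; nra.
have gr : in_L2 (fun x => U e (U t f0) x - a (t + e) x).
  by apply: in_L2B => //; exact: (exp_L2 gU).
(* By the group law and isometry, [phi (t + e)] and [phi t] are the distances from [U e (U t f0)] to
   [a (t + e)] and to [U e (a t)]. They differ by at most [err], the distance between the last
   two. *)
have phiS : phi (t + e) = fine (L2norm (fun x => U e (U t f0) x - a (t + e) x)).
  congr fine; apply: L2norm_ae; [exact: in_L2_mspinor..|].
  have := exp_D gU e t Lf0; rewrite addrC; apply: filterS => x /= H _.
  by rewrite H.
have phiU : phi t = fine (L2norm (fun x => U e (U t f0) x - U e (a t) x)).
  by rewrite (exp_group_isometry e gU).
have mUU : mspinor (U e (U t f0)) by apply: in_L2_mspinor; exact: (exp_L2 gU).
have LUU : in_L2 (fun x => U e (U t f0) x - U e (a t) x).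
  by apply: in_L2B; exact: (exp_L2 gU).
apply: le_trans err_le; rewrite ler_norml; apply/andP; split.
- rewrite lerNl opprB lerBlDr -lee_fin EFinD -errE phiU phiS !fineK ?L2norm_fin//.
  rewrite -(L2normN (in_L2_mspinor LE)).
  rewrite [leLHS](_ : _ = L2norm (fun x => - (U e (a t) x - a (t + e) x)
    + (U e (U t f0) x - a (t + e) x))).
    apply: L2normD; last exact: in_L2_mspinor.
    have -> : (fun x => - (U e (a t) x - a (t + e) x)) =
        (fun x => (-1) *: (U e (a t) x - a (t + e) x)).
      by apply/funext => x; rewrite scaleN1r.
    exact/mspinorZ/in_L2_mspinor.
  congr L2norm; apply/funext => x; by rewrite opprB [RHS]addrC addrA subrK.
- rewrite lerBlDr -lee_fin EFinD -errE phiU phiS !fineK ?L2norm_fin//.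
  rewrite [leLHS](_ : _ = L2norm (fun x => (U e (a t) x - a (t + e) x)
    + (U e (U t f0) x - U e (a t) x))).
    by apply: L2normD; exact: in_L2_mspinor.
  by congr L2norm; apply/funext => x; rewrite [RHS]addrC addrA subrK.
Qed.

End unitary_groups.

(** * The ansatz as an approximate solution *)

Section ansatz_evolution.
Context {R : realType}.
Local Notation M2 := (measurableTypeR R * measurableTypeR R)%type.
Local Notation der x f d := (is_derive (x : R) (1 : R) (f : R -> R) (d : R)).

Lemma schwartz_measurable (p : R -> R) n : schwartz_real p ->
  measurable_fun setT (derive1n n p).
Proof.
move=> sp; apply: continuous_measurable_fun.
exact: der_continuous (fun x => schwartz_der n x sp).
Qed.

Lemma half_i : ('i / 2%:R : R[i]) = (0 +i* (1 / 2))%C.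
Proof.
have n2 : (2%:R : R[i]) != 0 by rewrite pnatr_eq0.
have two : (2%:R : R[i]) = (2%:R)%:C%C by rewrite rmorph_nat.
apply: (mulIf n2); rewrite divfK// two; apply: complex_eq.
  by rewrite Re_imag ReZ/=; ring.
by rewrite Im_imag ImZ/=; field.
Qed.

Lemma ReN (z : R[i]) : complex.Re (- z) = - complex.Re z.
Proof. by case: z. Qed.

Lemma ImN (z : R[i]) : complex.Im (- z) = - complex.Im z.
Proof. by case: z. Qed.

Lemma norm_le_eq (x y k : R) : `|y| <= k -> x = y -> `|x| <= k.
Proof. by move=> + ->. Qed.

(** Multiplication by [i / 2] exchanges the real part [p] and the imaginary part [q] of [g], whence
    [- (1 / 2)] with [q] and [1 / 2] with [p] in the lower component. *)
Lemma ansatz_spinf (m h : R -> R) (C0 : R) (g : R -> R[i]) (eps t : R) :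
  ansatz m h C0 g eps t =
  let p := fun s => complex.Re (g s) in let q := fun s => complex.Im (g s) in
  spinf (packet m C0 h eps t 1 0 p) (packet m C0 h eps t 1 0 q)
        (packet m C0 h eps t 0 (- (1 / 2)) q) (packet m C0 h eps t 0 (1 / 2) p).
Proof.
apply/funext => x; rewrite /ansatz /spinf /packet /=.
set u := x.1 + h _; set z := - eps * _ * u + x.2 - t.
have -> : phase h eps t x = z by rewrite /phase /z /edge_dist /edge /edge_d1 -/u; ring.
rewrite -[edge_dist h eps x]/u -[edge_d1 h eps x.2]/(eps * h^`()%classic (eps * x.2)).
rewrite half_i; case: (g z) => a b.
apply: spinP; rewrite ?spin0 ?spin1 /mk_spinor !mxE /=; apply: complex_eq;
  rewrite ?ReZ ?ImZ /=; rewrite ?ReZ ?ImZ /=; ring.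
Qed.

Lemma in_L2_spinf (h : R -> R) (eps t : R) (A B C D : R * R -> R) :
  measurable_fun setT (edge h eps) ->
  measurable_fun (setT : set M2) A -> measurable_fun (setT : set M2) B ->
  measurable_fun (setT : set M2) C -> measurable_fun (setT : set M2) D ->
  dominated h eps t A -> dominated h eps t B ->
  dominated h eps t C -> dominated h eps t D ->
  in_L2 (spinf A B C D : field2 R).
Proof.
move=> mk mA mB mC mD [a a0 HA] [b b0 HB] [c c0 HC] [d d0 HD].
have mf := mspinor_spinf mA mB mC mD; have [mr mi] := mf.
split=> //; apply: le_lt_trans (ltry (2 * (a + b + c + d) * pi)).
apply: (L2norm_omega (t := t) mf mk); first by rewrite mulr_ge0 ?addr_ge0.
move=> x; rewrite -mulrA; have o0 := omega_ge0 (edge h eps) t x.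
by apply: spin_norm_le; [apply: le_trans (HA x) _|apply: le_trans (HB x) _|
  apply: le_trans (HC x) _|apply: le_trans (HD x) _]; rewrite ler_wpM2r//; lra.
Qed.

(** Supplies the step of [duhamel_bound] with rate [K1 * eps ^+ 2]. The constant [K2] carries no
    power of [eps]; this is harmless, since its term is quadratic in the increment and leaves no
    trace in the rate. *)
Lemma ansatz_step (m : R -> R) (C0 : R) (g : R -> R[i]) (h : R -> R)
    (wm : domain_wall m) (C0_gt0 : 0 < C0) (gS : schwartz g) (hC2 : class_C2 h)
    (B1 B2 : R) (hB1 : forall x, `|derive1 h x| <= B1)
    (hB2 : forall x, `|derive1n 2 h x| <= B2) :
  exists K1 K2 : R, [/\ 0 <= K1, 0 <= K2 &
    forall eps, 0 <= eps <= 1 -> (forall t, in_L2 (ansatz m h C0 g eps t)) /\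
    forall t, exists w, [/\ in_L2 w, dirac_op m h eps (ansatz m h C0 g eps t) w &
      forall d : R, `|d| <= 1 ->
      (L2norm (fun x => ansatz m h C0 g eps t x - ansatz m h C0 g eps (t + d)%R x
         + d%:C%C *: ('i *: w x))%R <=
        (`|d| * (K1 * eps ^+ 2) + d ^+ 2 * K2)%:E)%E]].
Proof.
case: gS => pS qS.
pose p s := complex.Re (g s); pose q s := complex.Im (g s).
pose p' := derive1n 1 p; pose q' := derive1n 1 q.
have dp x : der x p (p' x) := schwartz_der 0 x pS.
have dq x : der x q (q' x) := schwartz_der 0 x qS.
have mp : measurable_fun setT p := schwartz_measurable 0 pS.
have mq : measurable_fun setT q := schwartz_measurable 0 qS.
have mp' : measurable_fun setT p' := schwartz_measurable 1 pS.
have mq' : measurable_fun setT q' := schwartz_measurable 1 qS.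
have [c1 c10 H1] := schwartz_decay 0 pS; have [c2 c20 H2] := schwartz_decay 1 pS.
have [c3 c30 H3] := schwartz_decay 0 qS; have [c4 c40 H4] := schwartz_decay 1 qS.
have [T1 T10 HT1] := schwartz_taylor pS; have [T2 T20 HT2] := schwartz_taylor qS.
pose C := c1 + c2 + c3 + c4; pose T := T1 + T2.
have C_ge0 : 0 <= C by rewrite !addr_ge0.
have T_ge0 : 0 <= T by rewrite addr_ge0.
have pC s : (1 + `|s|) * `|p s| <= C by apply: (le_trans (H1 s)); rewrite /C; lra.
have p'C s : (1 + `|s|) * `|p' s| <= C by apply: (le_trans (H2 s)); rewrite /C; lra.
have qC s : (1 + `|s|) * `|q s| <= C by apply: (le_trans (H3 s)); rewrite /C; lra.
have q'C s : (1 + `|s|) * `|q' s| <= C by apply: (le_trans (H4 s)); rewrite /C; lra.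
have pT d s : `|d| <= 1 -> (1 + `|s|) * `|p (s - d) - p s + d * p' s| <= T * d ^+ 2.
  by move=> d1; apply: (le_trans (HT1 d s d1)); rewrite ler_wpM2r ?sqr_ge0// /T; lra.
have qT d s : `|d| <= 1 -> (1 + `|s|) * `|q (s - d) - q s + d * q' s| <= T * d ^+ 2.
  by move=> d1; apply: (le_trans (HT2 d s d1)); rewrite ler_wpM2r ?sqr_ge0// /T; lra.
have [M M0 mM] := domain_wall_bounded wm.
have [K K0 HK] := weight_bound wm C0_gt0 hB1.
have B10 : 0 <= B1 := le_trans (normr_ge0 _) (hB1 0).
have B20 : 0 <= B2 := le_trans (normr_ge0 _) (hB2 0).
pose Ka := (B1 ^+ 2 / 2 + B2) * (K * C).
pose Kb := (B2 / 2 + B1 ^+ 2 * M / 2 + B1 * (B1 ^+ 2 + B2) / 2) * (K * C).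
pose La := K * T; pose Lb := B1 / 2 * (K * T).
have Ka0 : 0 <= Ka by rewrite mulr_ge0 ?addr_ge0 ?mulr_ge0 ?exprn_ge0 ?invr_ge0.
have Kb0 : 0 <= Kb by rewrite !(mulr_ge0, addr_ge0, exprn_ge0, invr_ge0).
have La0 : 0 <= La by rewrite mulr_ge0.
have Lb0 : 0 <= Lb by rewrite !(mulr_ge0, invr_ge0).
have pi0 : 0 <= pi :> R := pi_ge0 R.
(* The [2] bounds the norm of a spinor by its four real coordinates, and [pi] bounds the [L^2] norm
   of [omega]. *)
exists (2 * (Ka + Kb) * pi), (2 * (La + Lb) * pi); split.
- by apply: mulr_ge0 => //; apply: mulr_ge0 => //; exact: addr_ge0.
- by apply: mulr_ge0 => //; apply: mulr_ge0 => //; exact: addr_ge0.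
move=> eps eps01.
have mk := measurable_edge hC2 eps.
pose pk t b0 b1 r := packet m C0 h eps t b0 b1 r.
have mpk t b0 b1 r : measurable_fun setT r ->
    measurable_fun (setT : set M2) (pk t b0 b1 r).
  exact: measurable_packet.
have dpk t b0 b1 r : (forall s, (1 + `|s|) * `|r s| <= C) ->
    dominated h eps t (pk t b0 b1 r).
  by move=> rC; exact: (dominated_packet wm C0_gt0 hB1 t eps01 rC).
have LA t : in_L2 (ansatz m h C0 g eps t).
  rewrite ansatz_spinf; apply: (@in_L2_spinf h eps t) => //; try exact: mpk; exact: dpk.
split=> // t.
pose V x := m (edge_dist h eps x).
have mV : measurable_fun (setT : set M2) V.
  exact: (measurableT_comp (wall_measurable wm) (measurable_edge_dist hC2 eps)).
pose p1 b0 b1 r r' := packet1 m C0 h eps t b0 b1 r r'.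
pose p2 b0 b1 r r' := packet2 m C0 h eps t b0 b1 r r'.
pose A := pk t 1 0 p; pose B := pk t 1 0 q.
pose E := pk t 0 (- (1 / 2)) q; pose D := pk t 0 (1 / 2) p.
pose A1 := p1 1 0 p p'; pose B1' := p1 1 0 q q'.
pose E1 := p1 0 (- (1 / 2)) q q'; pose D1 := p1 0 (1 / 2) p p'.
pose A2 := p2 1 0 p p'; pose B2' := p2 1 0 q q'.
pose E2 := p2 0 (- (1 / 2)) q q'; pose D2 := p2 0 (1 / 2) p p'.
have mp1 b0 b1 r r' : measurable_fun setT r -> measurable_fun setT r' ->
    measurable_fun (setT : set M2) (p1 b0 b1 r r').
  exact: measurable_packet1.
have mp2 b0 b1 r r' : measurable_fun setT r -> measurable_fun setT r' ->
    measurable_fun (setT : set M2) (p2 b0 b1 r r').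
  exact: measurable_packet2.
have dp1 b0 b1 r r' : (forall s, (1 + `|s|) * `|r s| <= C) ->
    (forall s, (1 + `|s|) * `|r' s| <= C) -> dominated h eps t (p1 b0 b1 r r').
  by move=> rC r'C; exact: (dominated_packet1 wm C0_gt0 hB1 t eps01 rC r'C).
have dp2 b0 b1 r r' : (forall s, (1 + `|s|) * `|r s| <= C) ->
    (forall s, (1 + `|s|) * `|r' s| <= C) -> dominated h eps t (p2 b0 b1 r r').
  by move=> rC r'C; exact: (dominated_packet2 wm C0_gt0 hB1 hB2 t eps01 rC r'C).
(* The image of the ansatz under the operator, in real coordinates: ['i] times an [x.2] derivative
   swaps its real and imaginary parts, one of them with a sign. *)
pose w := spinf (fun x => - B2' x + (V x * E x + - E1 x))
  (fun x => A2 x + (V x * D x + - D1 x))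
  (fun x => V x * A x + A1 x + D2 x)
  (fun x => V x * B x + B1' x + - E2 x).
have mVf (F : R * R -> R) : measurable_fun (setT : set M2) F ->
    measurable_fun (setT : set M2) (fun x => V x * F x).
  by move=> mF; exact: measurable_funM.
have mN (F : R * R -> R) : measurable_fun (setT : set M2) F ->
    measurable_fun (setT : set M2) (fun x => - F x).
  by move=> mF; exact: measurableT_comp.
have dV (F : R * R -> R) : dominated h eps t F ->
    dominated h eps t (fun x => V x * F x).
  by apply: dominatedM => x; exact: mM.
have mA := mpk t 1 0 p mp; have mB := mpk t 1 0 q mq.
have mE := mpk t 0 (- (1 / 2)) q mq; have mD := mpk t 0 (1 / 2) p mp.
have mA1 := mp1 1 0 p p' mp mp'; have mB1 := mp1 1 0 q q' mq mq'.
have mE1 := mp1 0 (- (1 / 2)) q q' mq mq'; have mD1 := mp1 0 (1 / 2) p p' mp mp'.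
have mA2 := mp2 1 0 p p' mp mp'; have mB2 := mp2 1 0 q q' mq mq'.
have mE2 := mp2 0 (- (1 / 2)) q q' mq mq'; have mD2 := mp2 0 (1 / 2) p p' mp mp'.
have dA := dpk t 1 0 p pC; have dB := dpk t 1 0 q qC.
have dE := dpk t 0 (- (1 / 2)) q qC; have dD := dpk t 0 (1 / 2) p pC.
have dA1 := dp1 1 0 p p' pC p'C; have dB1 := dp1 1 0 q q' qC q'C.
have dE1 := dp1 0 (- (1 / 2)) q q' qC q'C; have dD1 := dp1 0 (1 / 2) p p' pC p'C.
have dA2 := dp2 1 0 p p' pC p'C; have dB2 := dp2 1 0 q q' qC q'C.
have dE2 := dp2 0 (- (1 / 2)) q q' qC q'C; have dD2 := dp2 0 (1 / 2) p p' pC p'C.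
have Lw : in_L2 w.
  apply: (in_L2_spinf (h := h) (eps := eps) (t := t)); first exact: mk.
  - exact: measurable_funD (mN _ mB2) (measurable_funD (mVf _ mE) (mN _ mE1)).
  - exact: measurable_funD mA2 (measurable_funD (mVf _ mD) (mN _ mD1)).
  - exact: measurable_funD (measurable_funD (mVf _ mA) mA1) mD2.
  - exact: measurable_funD (measurable_funD (mVf _ mB) mB1) (mN _ mE2).
  - exact: dominatedD (dominatedN dB2) (dominatedD (dV _ dE) (dominatedN dE1)).
  - exact: dominatedD dA2 (dominatedD (dV _ dD) (dominatedN dD1)).
  - exact: dominatedD (dominatedD (dV _ dA) dA1) dD2.
  - exact: dominatedD (dominatedD (dV _ dB) dB1) (dominatedN dE2).
exists w; split => //.
- exists (spinf A1 B1' E1 D1), (spinf A2 B2' E2 D2); split.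
    split => //.
    + exact: in_L2_spinf mk mA1 mB1 mE1 mD1 dA1 dB1 dE1 dD1.
    + exact: in_L2_spinf mk mA2 mB2 mE2 mD2 dA2 dB2 dE2 dD2.
    + rewrite ansatz_spinf; apply: spinf_weak.
      * exact: (weak_derivative1_packet wm C0_gt0 hC2 hB1 hB2 t eps01 dp pC p'C mp mp').
      * exact: (weak_derivative1_packet wm C0_gt0 hC2 hB1 hB2 t eps01 dq qC q'C mq mq').
      * exact: (weak_derivative1_packet wm C0_gt0 hC2 hB1 hB2 t eps01 dq qC q'C mq mq').
      * exact: (weak_derivative1_packet wm C0_gt0 hC2 hB1 hB2 t eps01 dp pC p'C mp mp').
    + rewrite ansatz_spinf; apply: spinf_weak.
      * exact: (weak_derivative2_packet wm C0_gt0 hC2 hB1 hB2 t eps01 dp pC p'C mp mp').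
      * exact: (weak_derivative2_packet wm C0_gt0 hC2 hB1 hB2 t eps01 dq qC q'C mq mq').
      * exact: (weak_derivative2_packet wm C0_gt0 hC2 hB1 hB2 t eps01 dq qC q'C mq mq').
      * exact: (weak_derivative2_packet wm C0_gt0 hC2 hB1 hB2 t eps01 dp pC p'C mp mp').
  apply: aeW => x _; rewrite ansatz_spinf /w /spinf /= !spin0 !spin1.
  rewrite /spin; congr mk_spinor; apply: complex_eq;
    rewrite !(ReD, ImD, ReN, ImN, ReZ, ImZ) ?Re_imag ?Im_imag /=
      -[m (x.1 + h (eps * x.2))]/(V x);
    rewrite /A /B /E /D /pk; ring.
move=> d d1.
(* The constants of the two equations are added, so that one multiple of [omega] bounds all four
   real coordinates. *)
set Kd := `|d| * (Ka + Kb) * eps ^+ 2 + d ^+ 2 * (La + Lb).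
have Kd0 : 0 <= Kd.
  exact: addr_ge0 (mulr_ge0 (mulr_ge0 (normr_ge0 d) (addr_ge0 Ka0 Kb0)) (sqr_ge0 eps))
    (mulr_ge0 (sqr_ge0 d) (addr_ge0 La0 Lb0)).
rewrite [X in (_ <= X%:E)%E](_ : _ = 2 * Kd * pi); last by rewrite /Kd; ring.
have mLA s : mspinor (ansatz m h C0 g eps s) by exact: in_L2_mspinor.
have mS : mspinor (fun x => ansatz m h C0 g eps t x - ansatz m h C0 g eps (t + d) x
    + d%:C%C *: ('i *: w x)).
  apply: mspinorD; first exact: mspinorB.
  by do 2!apply: mspinorZ; exact: in_L2_mspinor.
apply: (L2norm_omega (t := t) mS mk); first by rewrite mulr_ge0.
move=> x; rewrite !ansatz_spinf /w /spinf /= spin_i spinZ spinN !spinD -mulrA.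
have o0 := omega_ge0 (edge h eps) t x.
have le_a z : z <= (`|d| * eps ^+ 2 * Ka + d ^+ 2 * La) * omega (edge h eps) t x ->
    z <= Kd * omega (edge h eps) t x.
  move=> /le_trans; apply; rewrite ler_wpM2r// -subr_ge0.
  rewrite (_ : _ - _ = `|d| * Kb * eps ^+ 2 + d ^+ 2 * Lb); last by rewrite /Kd; ring.
  exact: addr_ge0 (mulr_ge0 (mulr_ge0 (normr_ge0 d) Kb0) (sqr_ge0 eps))
    (mulr_ge0 (sqr_ge0 d) Lb0).
have le_b z : z <= (`|d| * eps ^+ 2 * Kb + d ^+ 2 * Lb) * omega (edge h eps) t x ->
    z <= Kd * omega (edge h eps) t x.
  move=> /le_trans; apply; rewrite ler_wpM2r// -subr_ge0.
  rewrite (_ : _ - _ = `|d| * Ka * eps ^+ 2 + d ^+ 2 * La); last by rewrite /Kd; ring.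
  exact: addr_ge0 (mulr_ge0 (mulr_ge0 (normr_ge0 d) Ka0) (sqr_ge0 eps))
    (mulr_ge0 (sqr_ge0 d) La0).
have Rp := residual_fst hB1 hB2 HK p'C pT t x eps01 d1.
have Rq := residual_fst hB1 hB2 HK q'C qT t x eps01 d1.
have Sp := residual_snd hB1 hB2 mM HK pC p'C pT t x eps01 d1.
have Sq := residual_snd hB1 hB2 mM HK qC q'C qT t x eps01 d1.
apply: spin_norm_le.
- apply: le_a; apply: (norm_le_eq Rp).
  by rewrite /A2 /D /D1 /p1 /p2 /pk /V; ring.
- apply: le_a; apply: (norm_le_eq Rq).
  by rewrite /B2' /E /E1 /p1 /p2 /pk /V /packet /packet1; ring.
(* This coordinate has coefficient [- (1 / 2)]: it is the opposite of the residual of [q]. *)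
- rewrite -normrN; apply: le_b; apply: (norm_le_eq Sq).
  by rewrite /B /B1' /E2 /p1 /p2 /pk /V /packet /packet2; ring.
- apply: le_b; apply: (norm_le_eq Sp).
  by rewrite /A /A1 /D2 /p1 /p2 /pk /V; ring.
Qed.

End ansatz_evolution.

Theorem theorem4p1 (R : realType) (m : R -> R) (C0 : R) (g : R -> R[i])
    (h : R -> R)
    (m_wall : domain_wall m)
    (C0_gt0 : 0 < C0)
    (chi_normalized :
       'N[@lebesgue_measure R]_2%:E [EFin \o chi m C0]%E = 1%E)
    (g_schwartz : schwartz g)
    (h_C2 : class_C2 h)
    (h'_bounded : exists M : R, forall x, `|derive1 h x| <= M)
    (h''_bounded : exists M : R, forall x, `|derive1n 2 h x| <= M) :
  exists C eps0 : R, [/\ 0 < C, 0 < eps0 &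
    forall eps : R, 0 < eps < eps0 ->
    forall alpha : R -> field2 R,
      dirac_solution m h eps alpha ->
      alpha 0 = ansatz m h C0 g eps 0 %[ae leb2 R] ->
    forall t : R, 0 < t ->
      (L2norm (fun x => (alpha t x - ansatz m h C0 g eps t x)%R)
        < (C * t * eps ^+ 2)%:E)%E].
Proof.
have aeF := ae_filter_ringOfSetsType (leb2 R).
have [B1 hB1] := h'_bounded; have [B2 hB2] := h''_bounded.
have [K1 [K2 [K10 K20 step]]] := ansatz_step m_wall C0_gt0 g_schwartz h_C2 hB1 hB2.
(* With [eta = eps ^+ 2] the growth rate is [(K1 + 1) * eps ^+ 2]; one more unit makes the
   inequality strict, as [t > 0]. The threshold [1] is the range of [eps] in which the estimates are
   uniform. *)
exists (K1 + 2), 1; split => //; first by lra.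
move=> eps /andP[eps0 eps1] alpha [Lalpha [U gU alphaE]] alpha0 t t0.
have eps01 : 0 <= eps <= 1 by rewrite !ltW.
have [LA stepE] := step eps eps01.
have E2 : 0 < eps ^+ 2 by rewrite exprn_gt0.
have := duhamel_bound gU (mulr_ge0 K10 (ltW E2)) K20 (Lalpha 0) alpha0 LA stepE
  E2 (ltW t0).
have -> : L2norm (fun x => U t (alpha 0) x - ansatz m h C0 g eps t x) =
    L2norm (fun x => alpha t x - ansatz m h C0 g eps t x).
  apply: L2norm_ae.
  - by apply: in_L2_mspinor; apply: in_L2B => //; exact: (exp_L2 gU).
  - by apply: in_L2_mspinor; exact: in_L2B.
  by have := alphaE t; apply: filterS => x /= H _; rewrite H.
move=> /le_lt_trans; apply; rewrite lte_fin.
by have := mulr_gt0 t0 E2; nra.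
Qed.
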